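(* Let $\Sigma$ be a finite set and $T=T_{\mathrm{MSO}(\Sigma^* )}$. For each $k\in\mathbb{N}$ let $p_k:S(T)\to S_k$ send a complete theory $x\in S(T)$ to the $\approx_k$-class of any of its models. Then $(S(T),\otimes)$, together with the maps $(p_k)_{k\in\mathbb{N}}$, is the inverse limit in the category of topological monoids of the directed system consisting of the finite discrete monoids $(S_k,\otimes_k)$, $k\in\mathbb{N}$, with the parent maps $S_{k'}\to S_k$ ($k\le k'$) sending the $\approx_{k'}$-class of a structure to its $\approx_k$-class. (Equivalently, under the identification $S_k\cong\Sigma^*/\!\approx_k$, it is the inverse limit of the restriction of the system $\rho\mapsto\Sigma^*/\rho$ on $(\mathrm{Con}_\omega(\Sigma^* ),\supseteq)$ to the cofinal subset $\{\approx_k:k\in\mathbb{N}\}$.)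
   Context: $L_\Sigma$ is the first-order signature $\{\subseteq,\prec,\mathrm{At},\bot,(P_\sigma)_{\sigma\in\Sigma}\}$. Lower-case variables range over atoms; $X(x)$ abbreviates $x\subseteq X$. $T_{\mathrm{MSO}(\Sigma^* )}$ is the $L_\Sigma$-theory expressing: $\subseteq$ is the order of an atomic Boolean algebra with bottom $\bot$ and $\mathrm{At}$ its atoms; the atoms are linearly ordered by $\prec$, discretely, with least and greatest elements; every element other than $\bot$ lies above a $\prec$-least atom among those below it; $\forall X,Y(X\prec Y\leftrightarrow\exists x\exists y(X(x)\wedge Y(y)\wedge x\prec y))$; the $P_\sigma$ partition the atoms; and the comprehension schema $\forall\bar Y\exists Z\forall x(Z(x)\leftrightarrow\phi(x,\bar Y))$ for every $L_\Sigma$-formula $\phi(x,\bar Y)$. For a finite $\Sigma$-word $w:\alpha_w\to\Sigma$, $\mathrm{MSO}(w)$ is the $L_\Sigma$-structure with universe $\mathcal{P}(\alpha_w)$, $\subseteq$ inclusion, $A\prec B$ iff $a<b$ for some $a\in A,b\in B$, $\mathrm{At}$ the singletons, $\bot=\emptyset$, $P_\sigma=\{\{a\}:w(a)=\sigma\}$. $\mathcal{M}\approx_k\mathcal{N}$ means that the structures satisfy the same sentences of quantifier depth $\le k$. For $L_\Sigma$-structures $\mathcal{M},\mathcal{N}$, $\mathcal{M}\otimes\mathcal{N}$ has universe $\mathcal{M}\times\mathcal{N}$; $\subseteq$ componentwise; $\bot=(\bot,\bot)$; $\mathrm{At}$ consists of the $(A,\bot)$ with $A$ an atom of $\mathcal{M}$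 and $(\bot,B)$ with $B$ an atom of $\mathcal{N}$; $(A,B)\prec(C,D)$ iff ($A\neq\bot$ and $D\neq\bot$) or $A\prec C$ in $\mathcal{M}$ or $B\prec D$ in $\mathcal{N}$; $P_\sigma((A,B))$ iff ($P_\sigma(A)$ and $B=\bot$) or ($A=\bot$ and $P_\sigma(B)$). The relation $\approx_k$ is a congruence for $\otimes$ on models of $T$. $S_k$ is the set of $\approx_k$-classes containing some $\mathrm{MSO}(w)$, $w\in\Sigma^*$; $\otimes_k$ is the operation on $S_k$ induced by $\otimes$; $(S_k,\otimes_k)$ is a finite monoid, given the discrete topology. $S(T)$ is the set of complete $L_\Sigma$-theories containing $T$, with topology having basis $\langle\phi\rangle=\{x:\phi\in x\}$ for sentences $\phi$, and $x\otimes y:=\mathrm{Th}(\mathcal{M}\otimes\mathcal{N})$ for any $\mathcal{M}\models x$, $\mathcal{N}\models y$ (well defined, in $S(T)$). An inverse limit of a directed system $F$ of topological monoids is a cone $(M,(\pi_i))$ over $F$ (continuous homomorphisms commuting with the system maps) such that every other cone factors through it via a unique continuous homomorphism.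
   Formalization: The axiom that the atoms have a least and a greatest element is required only when there is at least one atom; otherwise the empty word would not give a model of T and S(T) would have no unit. *)

(* Defs.v *)
From HB Require Import structures.
From mathcomp Require Import all_boot all_classical.
From mathcomp Require Import topology.

Set Implicit Arguments.
Unset Strict Implicit.
Unset Printing Implicit Defensive.

Local Open Scope classical_set_scope.

Inductive term := Var of nat | Bot.
Coercion Var : nat >-> term.

Inductive formula (Sigma : Type) :=
  | Eq of term & term
  | Sub of term & term
  | Prec of term & term
  | At of term
  | Lab of Sigma & term
  | Fls
  | Imp of formula Sigma & formula Sigma
  | All of nat & formula Sigma.

Arguments Eq {Sigma}.
Arguments Sub {Sigma}.
Arguments Prec {Sigma}.
Arguments At {Sigma}.
Arguments Fls {Sigma}.

Declare Scope fol_scope.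
Delimit Scope fol_scope with F.
Bind Scope fol_scope with formula.

Section DerivedConnectives.
Context {Sigma : Type}.
Implicit Types f g : formula Sigma.

Definition Not f := Imp f Fls.
Definition Or f g := Imp (Not f) g.
Definition And f g := Not (Imp f (Not g)).
Definition Iff f g := And (Imp f g) (Imp g f).
Definition Ex x f := Not (All x (Not f)).

Definition AllAt x f := All x (Imp (At x) f).
Definition ExAt x f := Ex x (And (At x) f).

Definition Alls xs f := foldr (@All Sigma) f xs.

End DerivedConnectives.

Notation "~ f" := (Not f) : fol_scope.
Notation "f /\ g" := (And f g) : fol_scope.
Notation "f \/ g" := (Or f g) : fol_scope.
Notation "f -> g" := (Imp f g) : fol_scope.
Notation "f <-> g" := (Iff f g) : fol_scope.
Notation "t <= u" := (Sub t u) : fol_scope.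
Notation "t < u" := (Prec t u) : fol_scope.
Notation "t = u" := (Eq t u) : fol_scope.

Section Syntax.
Context {Sigma : Type}.
Implicit Types f : formula Sigma.

Definition fv_term t := if t is Var x then [:: x] else [::].

Fixpoint fv f : seq nat :=
  match f with
  | Eq t u | Sub t u | Prec t u => fv_term t ++ fv_term u
  | At t | Lab _ t => fv_term t
  | Fls => [::]
  | Imp g h => fv g ++ fv h
  | All x g => [seq y <- fv g | y != x]
  end.

Definition sentence f := fv f = [::].

Fixpoint depth f : nat :=
  match f with
  | Imp g h => maxn (depth g) (depth h)
  | All _ g => (depth g).+1
  | _ => 0
  end.

Definition univ_closure f := Alls (fv f) f.

End Syntax.

Record structure (Sigma : Type) := Structure {
  dom :> Type;
  s_sub : dom -> dom -> Prop;
  s_prec : dom -> dom -> Prop;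
  s_at : dom -> Prop;
  s_bot : dom;
  s_lab : Sigma -> dom -> Prop
}.

Section Semantics.
Context {Sigma : Type}.
Implicit Types (M N : structure Sigma) (f : formula Sigma).

Definition eval_term M (e : nat -> M) t := if t is Var x then e x else s_bot M.

Definition upd (D : Type) (e : nat -> D) x (a : D) : nat -> D :=
  fun y => if y == x then a else e y.

Fixpoint sat M (e : nat -> M) f : Prop :=
  match f with
  | Eq t u => eval_term e t = eval_term e u
  | Sub t u => s_sub (eval_term e t) (eval_term e u)
  | Prec t u => s_prec (eval_term e t) (eval_term e u)
  | At t => s_at (eval_term e t)
  | Lab s t => s_lab s (eval_term e t)
  | Fls => False
  | Imp g h => sat e g -> sat e h
  | All x g => forall a : M, sat (upd e x a) g
  end.

Definition models M f := forall e : nat -> M, sat e f.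

Definition models_all M (x : formula Sigma -> Prop) := forall f, x f -> models M f.

Definition Th M : set (formula Sigma) := [set f | sentence f /\ models M f].

Definition approx k M N :=
  forall f, sentence f -> depth f <= k -> models M f <-> models N f.

Definition approx_class k M : set (structure Sigma) := [set N | approx k M N].

End Semantics.

(** In [is_join], [is_meet] and [is_top] the variable 9 is bound, so it must not
    be passed as an argument. *)

Section TheoryT.
Context {Sigma : finType}.

Definition is_join (s t u : term) : formula Sigma :=
  (t <= s /\ u <= s /\ All 9 (t <= 9 -> u <= 9 -> s <= 9))%F.

Definition is_meet (s t u : term) : formula Sigma :=
  (s <= t /\ s <= u /\ All 9 (9 <= t -> 9 <= u -> 9 <= s))%F.

Definition is_top (s : term) : formula Sigma := All 9 (9 <= s)%F.

Inductive T_MSO : set (formula Sigma) :=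
  (* [T_refl] to [T_atomic]: [Sub] is the order of an atomic Boolean algebra,
     possibly with one element, with bottom [Bot] and set of atoms [At] *)
  | T_refl : T_MSO (All 0 (0 <= 0)%F)
  | T_antisym : T_MSO (Alls [:: 0; 1] (0 <= 1 -> 1 <= 0 -> 0 = 1)%F)
  | T_trans : T_MSO (Alls [:: 0; 1; 2] (0 <= 1 -> 1 <= 2 -> 0 <= 2)%F)
  | T_bot : T_MSO (All 0 (Bot <= 0)%F)
  | T_join : T_MSO (Alls [:: 0; 1] (Ex 2 (is_join 2 0 1)))
  | T_meet : T_MSO (Alls [:: 0; 1] (Ex 2 (is_meet 2 0 1)))
  (* 0 meet (1 join 2) = (0 meet 1) join (0 meet 2), where 3 is 1 join 2, 4 is
     0 meet 3, 5 is 0 meet 1 and 6 is 0 meet 2 *)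
  | T_distr : T_MSO (Alls [:: 0; 1; 2; 3; 4; 5; 6]
      (is_join 3 1 2 -> is_meet 4 0 3 -> is_meet 5 0 1 -> is_meet 6 0 2 ->
       is_join 4 5 6)%F)
  | T_compl : T_MSO (All 0 (Ex 1 (Ex 2
      (is_top 2 /\ is_meet Bot 0 1 /\ is_join 2 0 1)%F)))
  | T_at : T_MSO (All 0
      (At 0 <-> ~ (0 = Bot) /\ All 1 (1 <= 0 -> 1 = Bot \/ 1 = 0))%F)
  | T_atomic : T_MSO (All 0 (~ (0 = Bot) -> ExAt 1 (1 <= 0))%F)
  (* [T_prec_irrefl] to [T_greatest]: [Prec] is a discrete strict linear order
     on the atoms, with endpoints if there are any atoms *)
  | T_prec_irrefl : T_MSO (AllAt 0 (~ (0 < 0))%F)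
  | T_prec_trans : T_MSO (AllAt 0 (AllAt 1 (AllAt 2
      (0 < 1 -> 1 < 2 -> 0 < 2)%F)))
  | T_prec_total : T_MSO (AllAt 0 (AllAt 1 (0 < 1 \/ 0 = 1 \/ 1 < 0)%F))
  | T_succ : T_MSO (AllAt 0 (ExAt 1 (0 < 1) ->
      ExAt 1 (0 < 1 /\ ~ ExAt 2 (0 < 2 /\ 2 < 1)))%F)
  | T_pred : T_MSO (AllAt 0 (ExAt 1 (1 < 0) ->
      ExAt 1 (1 < 0 /\ ~ ExAt 2 (1 < 2 /\ 2 < 0)))%F)
  | T_least : T_MSO (Ex 0 (At 0) -> ExAt 0 (AllAt 1 (0 = 1 \/ 0 < 1)))%F
  | T_greatest : T_MSO (Ex 0 (At 0) -> ExAt 0 (AllAt 1 (0 = 1 \/ 1 < 0)))%F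
  | T_least_below : T_MSO (All 0 (~ (0 = Bot) ->
      ExAt 1 (1 <= 0 /\ AllAt 2 (2 <= 0 -> 1 = 2 \/ 1 < 2)))%F)
  | T_prec : T_MSO (Alls [:: 0; 1]
      (0 < 1 <-> ExAt 2 (ExAt 3 (2 <= 0 /\ 3 <= 1 /\ 2 < 3)))%F)
  (* the labels partition the atoms, with possibly empty blocks *)
  | T_lab_at s : T_MSO (All 0 (Lab s 0 -> At 0)%F)
  | T_lab_cover : T_MSO
      (AllAt 0 (foldr Or Fls [seq Lab s 0 | s <- enum Sigma]))
  | T_lab_disj s s' : s != s' -> T_MSO (All 0 (~ (Lab s 0 /\ Lab s' 0))%F)
  | T_compr x z f : x != z -> z \notin fv f ->
      T_MSO (univ_closure (Ex z (AllAt x (x <= z <-> f)%F))).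

End TheoryT.

(** Positions are not taken in ['I_(size w)], nor sets of positions in
    [{set 'I_(size w)}]: these types are declared in [predArgType], whose universe
    is above that of the domains of structures as soon as sets of structures are
    formed. *)

Definition position (Sigma : Type) (w : seq Sigma) := {i : nat | i < size w}.

Definition letter (Sigma : Type) (w : seq Sigma) (a : position w) : Sigma :=
  tnth (in_tuple w) (Ordinal (proj2_sig a)).

Definition MSO (Sigma : Type) (w : seq Sigma) : structure Sigma :=
  {| dom := position w -> Prop;
     s_sub := fun A B => forall a, A a -> B a;
     s_prec := fun A B => exists a b, [/\ A a, B b & proj1_sig a < proj1_sig b];
     s_at := fun A => exists a, A = eq a;
     s_bot := fun=> False;
     s_lab := fun s A => exists2 a, A = eq a & letter a = s |}.

Definition otimes (Sigma : Type) (M N : structure Sigma) : structure Sigma :=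
  {| dom := M * N;
     s_sub := fun X Y => s_sub X.1 Y.1 /\ s_sub X.2 Y.2;
     s_prec := fun X Y => [\/ X.1 <> s_bot M /\ Y.2 <> s_bot N,
                              s_prec X.1 Y.1 | s_prec X.2 Y.2];
     s_at := fun X => (s_at X.1 /\ X.2 = s_bot N) \/ (X.1 = s_bot M /\ s_at X.2);
     s_bot := (s_bot M, s_bot N);
     s_lab := fun s X => (s_lab s X.1 /\ X.2 = s_bot N) \/
                         (X.1 = s_bot M /\ s_lab s X.2) |}.

Record ST (Sigma : finType) := MkST {
  ST_set :> formula Sigma -> Prop;
  ST_sentence : forall f, ST_set f -> sentence f;
  ST_sat : exists M : structure Sigma, models_all M ST_set;
  ST_complete : forall f, sentence f -> ST_set f \/ ST_set (Not f);
  ST_T : forall f, T_MSO f -> ST_set f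
}.

HB.instance Definition _ (Sigma : Type) := gen_eqMixin (formula Sigma).
HB.instance Definition _ (Sigma : Type) := gen_choiceMixin (formula Sigma).
HB.instance Definition _ (Sigma : Type) := isPointed.Build (formula Sigma) Fls.
HB.instance Definition _ (Sigma : finType) := gen_eqMixin (ST Sigma).
HB.instance Definition _ (Sigma : finType) := gen_choiceMixin (ST Sigma).

Section STTopology.
Context {Sigma : finType}.

Lemma sat_ext (M : structure Sigma) (f : formula Sigma) (e e' : nat -> M) :
  {in fv f, e =1 e'} -> sat e f <-> sat e' f.
Proof.
have evE t (d d' : nat -> M) : {in fv_term t, d =1 d'} -> eval_term d t = eval_term d' t.
  by case: t => [x|] //= H; apply: H; rewrite mem_head.
elim: f e e' => [t u|t u|t u|t|s t||g IHg h IHh|x g IHg] e e' /= H //.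
1-3: by rewrite (evE t e e') ?(evE u e e') // => x hx; apply: H;
       rewrite mem_cat hx ?orbT.
1-2: by rewrite (evE t e e').
- have Hg : sat e g <-> sat e' g.
    by apply: IHg => x hx; apply: H; rewrite mem_cat hx.
  have Hh : sat e h <-> sat e' h.
    by apply: IHh => x hx; apply: H; rewrite mem_cat hx orbT.
  tauto.
- have K a : sat (upd e x a) g <-> sat (upd e' x a) g.
    apply: IHg => y hy; rewrite /upd; case: eqP => // /eqP yx.
    by apply: H; rewrite mem_filter yx.
  by split=> Hs a; apply/K.
Qed.

Lemma sat_sentence (M : structure Sigma) (f : formula Sigma) (e : nat -> M) :
  sentence f -> sat e f -> models M f.
Proof. by move=> sf He e'; apply/(sat_ext (e := e)) => // x; rewrite sf. Qed.

(* A complete theory with a model is closed under semantic consequence. *)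
Lemma STE (x : ST Sigma) (M : structure Sigma) (f : formula Sigma) :
  models_all M x -> sentence f -> x f <-> models M f.
Proof.
move=> Mx sf; split=> [/Mx //|Mf]; have [//|xNf] := ST_complete x sf.
by case: (Mx _ xNf (fun=> s_bot M)); apply: Mf.
Qed.

Definition basic (f : formula Sigma) : set (ST Sigma) := [set x | x f].

Lemma basic_cover : \bigcup_(f in @sentence Sigma) basic f = setT.
Proof.
apply/seteqP; split=> // x _.
have [M Mx] := ST_sat x.
have sF : sentence (Sigma := Sigma) (Imp Fls Fls) by [].
by exists (Imp Fls Fls) => //; apply: (STE Mx sF).2 => e.
Qed.

Lemma basic_join (f g : formula Sigma) (x : ST Sigma) :
  sentence f -> sentence g -> basic f x -> basic g x ->
  exists h, [/\ sentence h, basic h x & basic h `<=` basic f `&` basic g].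
Proof.
move=> sf sg xf xg; have sfg : sentence (And f g) by rewrite /sentence /= sf sg.
have satA (M : structure Sigma) :
    models M (And f g) <-> models M f /\ models M g.
  split=> [H|[Hf Hg] e /= H]; last by exact: H (Hf e) (Hg e).
  have := H (fun=> s_bot M) => /= H0.
  by split; apply: contrapT => K; apply: H0 => If Ig; apply: K;
    apply: sat_sentence; eassumption.
exists (And f g); split=> //.
- have [M Mx] := ST_sat x.
  apply: (STE Mx sfg).2; apply/satA.
  by split; [apply: (STE Mx sf).1|apply: (STE Mx sg).1].
- move=> y; have [M My] := ST_sat y.
  move=> /(STE My sfg)/satA[Mf Mg].
  by split; [apply: (STE My sf).2|apply: (STE My sg).2].
Qed.

HB.instance Definition _ := isBaseTopological.Build (ST Sigma)
  basic_cover basic_join.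

End STTopology.

Record Sk (Sigma : finType) (k : nat) := MkSk {
  Sk_class :> structure Sigma -> Prop;
  Sk_word : exists w : seq Sigma, Sk_class = approx_class k (MSO w)
}.

HB.instance Definition _ (Sigma : finType) k := gen_eqMixin (Sk Sigma k).
HB.instance Definition _ (Sigma : finType) k := gen_choiceMixin (Sk Sigma k).

Section SkParent.
Context {Sigma : finType}.

Definition word_class k (w : seq Sigma) : Sk Sigma k :=
  MkSk (ex_intro _ w erefl).

Lemma parent_subproof k k' (le_kk' : k <= k') (c : Sk Sigma k') :
  exists w : seq Sigma,
    [set N | exists2 M, c M & approx k M N] = approx_class k (MSO w).
Proof.
have [w cE] := Sk_word c; exists w; rewrite cE.
apply/seteqP; split=> [N [M wM MN] f sf fk|N wN].
  by rewrite (wM f sf (leq_trans fk le_kk')); apply: MN.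
by exists (MSO w).
Qed.

Definition parent k k' (le_kk' : k <= k') (c : Sk Sigma k') : Sk Sigma k :=
  MkSk (parent_subproof le_kk' c).

End SkParent.

Record top_monoid_on (X : topologicalType) := TopMonoidOn {
  tm_mul : X -> X -> X;
  tm_one : X;
  tm_mulA : associative tm_mul;
  tm_mul1l : left_id tm_one tm_mul;
  tm_mul1r : right_id tm_one tm_mul;
  tm_mul_continuous : continuous (fun xy : X * X => tm_mul xy.1 xy.2)
}.

Record top_monoid := TopMonoid {
  tm_car :> topologicalType;
  tm_str :> top_monoid_on tm_car
}.

Definition tm_hom (M N : top_monoid) (h : M -> N) :=
  [/\ continuous h, h (tm_one M) = tm_one N &
      {morph h : x y / tm_mul M x y >-> tm_mul N x y}].

Section InverseLimit.
Context {I : Type} {leI : I -> I -> Prop} (F : I -> top_monoid).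
Variable f : forall i j, leI i j -> F j -> F i.

Record directed_system : Prop := DirectedSystem {
  ds_refl : forall i, leI i i;
  ds_trans : forall i j l, leI i j -> leI j l -> leI i l;
  ds_nonempty : exists i : I, True;
  ds_directed : forall i j, exists l, leI i l /\ leI j l;
  ds_hom : forall i j (ij : leI i j), tm_hom (f ij);
  ds_id : forall i (ii : leI i i) x, f ii x = x;
  ds_comp : forall i j l (ij : leI i j) (jl : leI j l) (il : leI i l) x,
    f ij (f jl x) = f il x
}.

Definition cone (M : top_monoid) (p : forall i, M -> F i) :=
  (forall i, tm_hom (p i)) /\
  forall i j (ij : leI i j) x, f ij (p j x) = p i x.

Definition inverse_limit (M : top_monoid) (p : forall i, M -> F i) :=
  cone p /\
  forall (N : top_monoid) (q : forall i, N -> F i), cone q ->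
    exists! h : N -> M, tm_hom h /\ forall i x, p i (h x) = q i x.

End InverseLimit.

Record fin_congruence (Sigma : Type) := FinCongruence {
  con_rel :> seq Sigma -> seq Sigma -> Prop;
  con_refl : forall u, con_rel u u;
  con_sym : forall u v, con_rel u v -> con_rel v u;
  con_trans : forall u v w, con_rel u v -> con_rel v w -> con_rel u w;
  con_cat : forall u u' v v',
    con_rel u u' -> con_rel v v' -> con_rel (u ++ v) (u' ++ v');
  con_fin : finite_set (range (fun u => [set v | con_rel u v]))
}.

Record quot (Sigma : Type) (rho : fin_congruence Sigma) := MkQuot {
  quot_class :> seq Sigma -> Prop;
  quot_word : exists w, quot_class = [set v | rho w v]
}.

HB.instance Definition _ (Sigma : Type) (rho : fin_congruence Sigma) :=
  gen_eqMixin (quot rho).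
HB.instance Definition _ (Sigma : Type) (rho : fin_congruence Sigma) :=
  gen_choiceMixin (quot rho).

Section Quotient.
Context {Sigma : Type}.
Implicit Types rho : fin_congruence Sigma.

Definition cls rho (w : seq Sigma) : quot rho := MkQuot (ex_intro _ w erefl).

Lemma con_setE rho u v :
  rho u v -> [set w | rho u w] = [set w | rho v w].
Proof.
move=> uv; apply/seteqP; split=> w /=; apply: con_trans => //.
exact: con_sym.
Qed.

Lemma quot_inj rho (C D : quot rho) : (C : set _) = D -> C = D.
Proof.
case: C D => C pC [D pD] /= E; move: pC pD; rewrite E => pC pD.
by rewrite (Prop_irrelevance pC pD).
Qed.

Lemma clsP rho (C : quot rho) : exists w, C = cls rho w.
Proof. by have [w Cw] := quot_word C; exists w; apply: quot_inj. Qed.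

Lemma quot_mul_subproof rho (C D : quot rho) :
  exists w, [set x | exists u v, [/\ C u, D v & rho (u ++ v) x]] =
            [set v | rho w v].
Proof.
have [[u ->] [v ->]] := (clsP C, clsP D); exists (u ++ v).
apply/seteqP; split=> [x [u' [v' [/= uu' vv' xuv]]]|x /= xuv].
  exact: con_trans (con_cat uu' vv') xuv.
by exists u, v; split=> //; apply: con_refl.
Qed.

Definition quot_mul rho (C D : quot rho) : quot rho :=
  MkQuot (quot_mul_subproof C D).

Lemma quot_mulE rho u v : quot_mul (cls rho u) (cls rho v) = cls rho (u ++ v).
Proof.
apply: quot_inj; apply/seteqP; split=> [x [u' [v' [/= uu' vv' xuv]]]|x /= xuv].
  exact: con_trans (con_cat uu' vv') xuv.
by exists u, v; split=> //; apply: con_refl.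
Qed.

Lemma quot_mulA rho : associative (@quot_mul rho).
Proof.
move=> C D E; have [[[u ->] [v ->]] [w ->]] := (clsP C, clsP D, clsP E).
by rewrite !quot_mulE catA.
Qed.

Lemma quot_mul1l rho : left_id (cls rho [::]) (@quot_mul rho).
Proof. by move=> C; have [u ->] := clsP C; rewrite quot_mulE. Qed.

Lemma quot_mul1r rho : right_id (cls rho [::]) (@quot_mul rho).
Proof. by move=> C; have [u ->] := clsP C; rewrite quot_mulE cats0. Qed.

Lemma quot_mul_continuous rho (X := discrete_topology (quot rho)) :
  continuous (fun xy : X * X => (quot_mul xy.1 xy.2 : X)).
Proof.
move=> [C D] A /= nA; exists ([set C], [set D]) => /=.
  by split; exact: discrete_set1.
by move=> [C' D'] /= [-> ->]; apply: nbhs_singleton nA.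
Qed.

Definition quot_monoid rho : top_monoid :=
  @TopMonoid (discrete_topology (quot rho))
    (@TopMonoidOn (discrete_topology (quot rho)) (@quot_mul rho)
       (cls rho [::]) (@quot_mulA rho) (@quot_mul1l rho) (@quot_mul1r rho)
       (@quot_mul_continuous rho)).

(* Reverse inclusion: finer congruences are greater. *)
Definition con_le rho rho' := forall u v, rho' u v -> rho u v.

Lemma quot_map_subproof rho rho' (le : con_le rho rho') (C : quot rho') :
  exists w, [set v | exists2 u, C u & rho u v] = [set v | rho w v].
Proof.
have [w ->] := clsP C; exists w; apply/seteqP; split=> [v [u /= wu uv]|v /= wv].
  exact: con_trans (le _ _ wu) uv.
by exists w => //; apply: con_refl.
Qed.

Definition quot_map rho rho' (le : con_le rho rho') (C : quot rho') : quot rho :=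
  MkQuot (quot_map_subproof le C).

End Quotient.

Definition word_approx (Sigma : Type) k (u v : seq Sigma) :=
  approx k (MSO u) (MSO v).

Record approx_con (Sigma : Type) := ApproxCon {
  ac_con :> fin_congruence Sigma;
  ac_approx : exists k, con_rel ac_con = word_approx k
}.

(* Main.v *)
From HB Require Import structures.
From mathcomp Require Import all_boot all_classical.
From mathcomp Require Import topology.
Require Import Defs.

Set Implicit Arguments.
Unset Strict Implicit.
Unset Printing Implicit Defensive.

Local Open Scope classical_set_scope.

(** Ranked Ehrenfeucht-Fraisse types form a finite set and are expressed by
    sentences, and the type of a product is determined by the types of its
    factors. In a model of T, comprehension and the least element principle show
    that every prefix has the rank-k type of a word, so every model of T is
    k-equivalent to a word, for each k. Hence the maps to the S_k are well
    defined, they separate the points of S(T), and their fibres form a base of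
    its topology. A compatible family of classes is realized by an ultraproduct
    of words, which gives the limit property. Finally, a finite congruence is
    recognized by a deterministic automaton whose acceptance is expressed by a
    sentence, so that it is coarser than some k-equivalence. *)

(** The only closed term is [Bot] and there are no function symbols, so finitely many variables
    carry finitely many atomic formulas; this lets types be elements of a [finType]. The main
    obstacle is that comprehension applies to a single formula evaluated in all of [M], whereas
    being equivalent to a word is a property of a substructure and a disjunction over infinitely
    many words. Finiteness of the set of types turns the disjunction into one sentence, and
    relativization transports that sentence into [M], with the prefix as a parameter. Once models of
    T are compared with words at each rank, preservation of the axioms by products and the monoid
    laws are read off from concatenation and return to S(T) rank by rank. Independence of the chosen
    models and representatives is always reduced to equality of classes of words. *)

HB.instance Definition _ := gen_eqMixin term.

(** * Types and Hintikka formulas *)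

Section Connectives.
Context {Sigma : Type}.
Implicit Types (M N : structure Sigma) (f g : formula Sigma).

Lemma sat_Not M (e : nat -> M) f : sat e (Not f) = ~ sat e f.
Proof. by []. Qed.

Lemma sat_Imp M (e : nat -> M) f g : sat e (Imp f g) = (sat e f -> sat e g).
Proof. by []. Qed.

Lemma sat_All M (e : nat -> M) x f :
  sat e (All x f) = (forall a, sat (upd e x a) f).
Proof. by []. Qed.

Lemma sat_And M (e : nat -> M) f g : sat e (And f g) = (sat e f /\ sat e g).
Proof. by apply/propext => /=; have := EM (sat e f); have := EM (sat e g); tauto. Qed.

Lemma sat_Or M (e : nat -> M) f g : sat e (Or f g) = (sat e f \/ sat e g).
Proof. by apply/propext => /=; have := EM (sat e f); tauto. Qed.

Lemma sat_Iff M (e : nat -> M) f g : sat e (Iff f g) = (sat e f <-> sat e g).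
Proof. by rewrite sat_And. Qed.

Lemma sat_Ex M (e : nat -> M) x f :
  sat e (Ex x f) = (exists a, sat (upd e x a) f).
Proof.
apply/propext; split=> [/= H|[a fa] /= /(_ a)]; last exact.
by apply: contrapT => nex; apply: H => a fa; apply: nex; exists a.
Qed.

Lemma sat_AllAt M (e : nat -> M) x f :
  sat e (AllAt x f) = (forall a, s_at a -> sat (upd e x a) f).
Proof. by rewrite /= /upd eqxx. Qed.

Lemma sat_ExAt M (e : nat -> M) x f :
  sat e (ExAt x f) = (exists2 a, s_at a & sat (upd e x a) f).
Proof.
rewrite sat_Ex; apply/propext; split=> [[a]|[a ata fa]].
  by rewrite sat_And /= {1}/upd eqxx => -[]; exists a.
by exists a; rewrite sat_And /= {1}/upd eqxx.
Qed.

Definition satE := (sat_And, sat_Or, sat_Iff, sat_Ex, sat_AllAt, sat_ExAt, sat_Not).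

Definition bigAnd (fs : seq (formula Sigma)) := foldr And (Not Fls) fs.
Definition bigOr (fs : seq (formula Sigma)) := foldr Or Fls fs.

Lemma sat_bigAnd M (e : nat -> M) (fs : seq (formula Sigma)) :
  sat e (bigAnd fs) <-> {in fs, forall f, sat e f}.
Proof.
elim: fs => [|f fs IH]; first by split=> [_ f|_ []].
rewrite [bigAnd _]/(And f (bigAnd fs)) sat_And; split=> [[ef /IH efs] g|H].
  by rewrite inE => /predU1P[->|/efs].
by split; [apply: H; rewrite mem_head|apply/IH => g gfs; apply: H; rewrite inE gfs orbT].
Qed.

Lemma sat_bigOr M (e : nat -> M) (fs : seq (formula Sigma)) :
  sat e (bigOr fs) <-> exists2 f, f \in fs & sat e f.
Proof.
elim: fs => [|f fs IH]; first by split=> [|[]].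
rewrite [bigOr _]/(Or f (bigOr fs)) sat_Or; split=> [[ef|/IH[g gfs eg]]|[g]].
- by exists f; rewrite ?mem_head.
- by exists g; rewrite // inE gfs orbT.
- by rewrite inE => /predU1P[->|gfs eg]; [left|right; apply/IH; exists g].
Qed.

Lemma depth_bigAnd k (fs : seq (formula Sigma)) :
  {in fs, forall f, depth f <= k} -> depth (bigAnd fs) <= k.
Proof.
elim: fs => //= f fs IH H; rewrite !geq_max /= H ?mem_head //= andbT IH //.
by move=> g gfs; apply: H; rewrite inE gfs orbT.
Qed.

Lemma depth_bigOr k (fs : seq (formula Sigma)) :
  {in fs, forall f, depth f <= k} -> depth (bigOr fs) <= k.
Proof.
elim: fs => //= f fs IH H; rewrite !geq_max /= H ?mem_head //= IH //.
by move=> g gfs; apply: H; rewrite inE gfs orbT.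
Qed.

Lemma fv_bigAnd (P : pred nat) (fs : seq (formula Sigma)) :
  {in fs, forall f, all P (fv f)} -> all P (fv (bigAnd fs)).
Proof.
elim: fs => //= f fs IH H; rewrite cats0 all_cat /= H ?mem_head //= cats0 IH //.
by move=> g gfs; apply: H; rewrite inE gfs orbT.
Qed.

Lemma fv_bigOr (P : pred nat) (fs : seq (formula Sigma)) :
  {in fs, forall f, all P (fv f)} -> all P (fv (bigOr fs)).
Proof.
elim: fs => //= f fs IH H; rewrite !all_cat /= H ?mem_head //= IH //.
by move=> g gfs; apply: H; rewrite inE gfs orbT.
Qed.

Lemma updE M (e : nat -> M) x a : upd e x a x = a.
Proof. by rewrite /upd eqxx. Qed.

Lemma sat_Alls M (e : nat -> M) xs f :
  sat e (Alls xs f) <->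
  forall d, (forall x, x \notin xs -> d x = e x) -> sat d f.
Proof.
elim: xs e => [|x xs IH] e.
  split=> [ef d de|]; last by apply.
  by rewrite (_ : d = e) //; apply/funext => x; apply: de.
split=> [H d de|H a].
  have /IH := H (d x); apply=> y ynxs; rewrite /upd; case: eqVneq => [->//|yx].
  by apply: de; rewrite inE negb_or yx.
apply/IH => d de; apply: H => y; rewrite inE negb_or => /andP[yx /de ->].
by rewrite /upd (negbTE yx).
Qed.

(** [models] already quantifies over all valuations, so a universal prefix changes nothing. Axioms
    and universal closures are thereby exchanged with their bodies. *)
Lemma models_Alls M xs f : models M (Alls xs f) <-> models M f.
Proof.
split=> H e; last by apply/sat_Alls => d _; apply: H.
by have /sat_Alls := H e; apply.
Qed.

Lemma models_All M x f : models M (All x f) <-> models M f.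
Proof. exact: (models_Alls M [:: x] f). Qed.

Lemma fv_Alls xs f : fv (Alls xs f) = [seq x <- fv f | x \notin xs].
Proof.
elim: xs => [|x xs IH] /=; first by rewrite filter_predT.
by rewrite IH -filter_predI; apply: eq_filter => y /=; rewrite inE negb_or.
Qed.

Lemma sentence_univ_closure f : sentence (univ_closure f).
Proof.
rewrite /sentence fv_Alls; apply/eqP; rewrite -[_ == _]negbK -has_filter.
by apply/hasPn => x xf; rewrite xf.
Qed.

End Connectives.

(** * Ehrenfeucht-Fraisse types of finite rank, and their behaviour under products *)

Section Types.
Context {Sigma : finType}.
Implicit Types (M N : structure Sigma) (f g : formula Sigma).

Definition terms n : seq term := Bot :: [seq Var i | i <- iota 0 n].

Definition atomics_over (ts : seq term) : seq (formula Sigma) :=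
  [seq Eq t u | t : term <- ts, u : term <- ts] ++
  [seq Sub t u | t : term <- ts, u : term <- ts] ++
  [seq Prec t u | t : term <- ts, u : term <- ts] ++
  [seq At t | t <- ts] ++
  [seq Lab s t | s : Sigma <- enum Sigma, t : term <- ts].

Definition atomics n := atomics_over (terms n).

Arguments atomics : simpl never.

Lemma mem_atomics n f : (f \in atomics n) =
  match f with
  | Eq t u | Sub t u | Prec t u => (t \in terms n) && (u \in terms n)
  | At t | Lab _ t => t \in terms n
  | _ => false
  end.
Proof.
rewrite /atomics; move: (terms n) => ts; rewrite !mem_cat; apply/idP/idP.
  case/orP=> [/allpairsP[[t u] /= [tn un ->]]|]; first exact/andP.
  case/orP=> [/allpairsP[[t u] /= [tn un ->]]|]; first exact/andP.
  case/orP=> [/allpairsP[[t u] /= [tn un ->]]|]; first exact/andP.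
  by case/orP=> [/mapP[t ? ->]|/allpairsP[[s t] /= [_ ? ->]]].
case: f => // [t u /andP[tn un]|t u /andP[tn un]|t u /andP[tn un]|t tn|s t tn].
- by rewrite allpairs_f.
- by rewrite (allpairs_f Sub) ?orbT.
- by rewrite (allpairs_f Prec) ?orbT.
- by rewrite (map_f At) ?orbT.
- by rewrite (allpairs_f (@Lab Sigma)) ?mem_enum ?orbT.
Qed.

Lemma mem_terms n t : (t \in terms n) = (if t is Var x then x < n else true).
Proof.
rewrite inE; case: t => [x|]; last by rewrite eqxx.
rewrite (_ : (Var x == Bot) = false) /=; last by apply/eqP.
by rewrite mem_map ?mem_iota // => i j [].
Qed.

(** Truth tables of atomic formulas, followed by iterated finite powersets: finiteness of the set of
    types of each rank is carried by the [finType] structure itself. *)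
Fixpoint tau k n : finType :=
  if k is k'.+1 then {set tau k' n.+1} else (size (atomics n)).-tuple bool.

(* The rank-[k] type of the first [n] values of [e]; the next value played is
   stored in the variable [n]. *)
Fixpoint tp k n M (e : nat -> M) : tau k n :=
  match k return tau k n with
  | 0 => map_tuple (fun f => `[< sat e f >]) (in_tuple (atomics n))
  | k'.+1 => [set t | `[< exists a, tp k' n.+1 (upd e n a) = t >]]%SET
  end.

(** The conjunction of existential formulas forces every member of the type to be realized, and the
    universal one forbids any other. Each rank costs one quantifier. *)
Fixpoint hintikka k n : tau k n -> formula Sigma :=
  match k return tau k n -> formula Sigma with
  | 0 => fun t => bigAnd [seq if fb.2 then fb.1 else Not fb.1 | fb <- zip (atomics n) (tval t)]
  | k'.+1 => fun t : {set tau k' n.+1} =>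
      And (bigAnd [seq Ex n (hintikka t') | t' <- enum t])
          (All n (bigOr [seq hintikka t' | t' <- enum t]))
  end.

Lemma map_asbool_zip M (e : nat -> M) fs (bs : seq bool) :
  size bs = size fs ->
  {in [seq if fb.2 then fb.1 else Not fb.1 | fb <- zip fs bs], forall f, sat e f} ->
  [seq `[< sat e f >] | f <- fs] = bs.
Proof.
elim: fs bs => [|f fs IH] [|b bs] //= [sz] H.
rewrite (IH bs) //; last by move=> g gfs; apply: H; rewrite inE gfs orbT.
congr cons; have /= := H _ (mem_head _ _).
by case: b {H} => H; [rewrite asboolT|rewrite asboolF].
Qed.

Lemma mem_zip1 (fs : seq (formula Sigma)) (bs : seq bool) f b :
  (f, b) \in zip fs bs -> f \in fs.
Proof.
elim: fs bs => [|g fs IH] [|c bs] //=.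
by rewrite !inE => /predU1P[[-> _]|/IH ->]; rewrite ?eqxx ?orbT.
Qed.

Lemma mem_tpS k n M (e : nat -> M) (t : tau k n.+1) :
  t \in (tp k.+1 n e : {set tau k n.+1}) <-> exists a, tp k n.+1 (upd e n a) = t.
Proof. by rewrite inE; split=> [/asboolP|?] //; apply/asboolP. Qed.

Lemma sat_hintikka k n M (e : nat -> M) (t : tau k n) :
  sat e (hintikka t) <-> tp k n e = t.
Proof.
elim: k n e t => [|k IH] n e t.
  rewrite sat_bigAnd /=; split=> [H|<-].
    apply/val_inj; rewrite [LHS]/=; exact: map_asbool_zip (size_tuple t) H.
  have zipE : zip (atomics n) [seq `[< sat e f >] | f <- atomics n] =
      [seq (f, `[< sat e f >]) | f <- atomics n].
    by rewrite -{1}[atomics n]map_id zip_map.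
  by move=> f; rewrite zipE => /mapP[? /mapP[g _ ->] ->] /=; case: asboolP.
rewrite [hintikka _]/(And _ _) sat_And sat_bigAnd; split=> [[H1 H2]|<-].
  apply/setP => t'; apply/idP/idP => [/mem_tpS[a at']|t't].
    have /sat_bigOr[f /mapP[t'' + ->]] := H2 a; rewrite mem_enum => t''t.
    by move/IH; rewrite at' => ->.
  have : Ex n (hintikka t') \in [seq Ex n (hintikka t') | t' <- enum t].
    by apply/mapP; exists t' => //; rewrite mem_enum.
  by move/H1; rewrite sat_Ex => -[a /IH at']; apply/mem_tpS; exists a.
split=> [f /mapP[t' + ->]|a].
  by rewrite mem_enum => /mem_tpS[a at']; rewrite sat_Ex; exists a; apply/IH.
apply/sat_bigOr; exists (hintikka (tp k n.+1 (upd e n a))); last exact/IH.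
by apply/map_f; rewrite mem_enum; apply/mem_tpS; exists a.
Qed.

Lemma fv_atomic n f : f \in atomics n -> all (fun i => i < n) (fv f).
Proof.
have fvt t : t \in terms n -> all (fun i => i < n) (fv_term t).
  by rewrite mem_terms; case: t => //= x ->.
rewrite mem_atomics; case: f => //= [t u|t u|t u].
1-3: by rewrite all_cat => /andP[/fvt -> /fvt].
all: exact: fvt.
Qed.

Lemma fv_hintikka k n (t : tau k n) : all (fun i => i < n) (fv (hintikka t)).
Proof.
elim: k n t => [|k IH] n t.
  apply: fv_bigAnd => f /mapP[[g b] /= gb ->].
  have /fv_atomic gn := mem_zip1 gb.
  by case: b gb => //= _; rewrite cats0.
have H t' : all (fun i => i < n) [seq y <- fv (hintikka (t' : tau k n.+1)) | y != n].
  apply/allP => i; rewrite mem_filter => /andP[in' /(allP (IH _ _))].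
  by rewrite ltnS leq_eqVlt (negbTE in').
rewrite /= !all_cat /= andbT; apply/andP; split.
  by apply: fv_bigAnd => f /mapP[t' _ ->] /=; rewrite !cats0 H.
rewrite andbT; apply/allP => i; rewrite mem_filter => /andP[in'].
have /allP H' : all (fun i => i < n.+1) (fv (bigOr [seq hintikka t' | t' <- enum (t : {set _})])).
  by apply: fv_bigOr => f /mapP[t' _ ->]; apply: IH.
by move=> /H'; rewrite ltnS leq_eqVlt (negbTE in').
Qed.

Lemma sentence_hintikka k (t : tau k 0) : sentence (hintikka t).
Proof. by rewrite /sentence; have := fv_hintikka t; case: (fv _). Qed.

Lemma depth_hintikka k n (t : tau k n) : depth (hintikka t) <= k.
Proof.
elim: k n t => [|k IH] n t.
  apply: depth_bigAnd => f /mapP[[g b] /= gb ->].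
  have dg : depth g = 0.
    by have := mem_zip1 gb; rewrite mem_atomics; case: (g).
  by case: b gb => /=; rewrite dg.
rewrite /= !geq_max /= andbT; apply/andP; split.
  by apply: depth_bigAnd => f /mapP[t' _ ->] /=; rewrite !geq_max /= ltnS IH.
by rewrite andbT ltnS; apply: depth_bigOr => f /mapP[t' _ ->]; apply: IH.
Qed.

Definition atomic_equiv n M N (e : nat -> M) (e' : nat -> N) :=
  forall t u, t \in terms n -> u \in terms n ->
  [/\ eval_term e t = eval_term e u <-> eval_term e' t = eval_term e' u,
      s_sub (eval_term e t) (eval_term e u) <-> s_sub (eval_term e' t) (eval_term e' u),
      s_prec (eval_term e t) (eval_term e u) <-> s_prec (eval_term e' t) (eval_term e' u),
      s_at (eval_term e t) <-> s_at (eval_term e' t)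
    & forall s, s_lab s (eval_term e t) <-> s_lab s (eval_term e' t)].

Lemma tp0P n M N (e : nat -> M) (e' : nat -> N) :
  tp 0 n e = tp 0 n e' <-> atomic_equiv n e e'.
Proof.
have -> : (tp 0 n e = tp 0 n e') <-> {in atomics n, forall f, sat e f <-> sat e' f}.
  split=> [E f fn|H].
    have /eq_in_map/(_ f fn) H : map (fun f => `[< sat e f >]) (atomics n) =
        map (fun f => `[< sat e' f >]) (atomics n) := congr1 val E.
    exact: asbool_eq_equiv.
  by apply/val_inj/eq_in_map => f /H; apply: asbool_equiv_eq.
split=> [H t u tn un|H f].
  split.
  - by apply: (H (Eq t u)); rewrite mem_atomics tn.
  - by apply: (H (Sub t u)); rewrite mem_atomics tn.
  - by apply: (H (Prec t u)); rewrite mem_atomics tn.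
  - by apply: (H (At t)); rewrite mem_atomics tn.
  - by move=> s; apply: (H (Lab s t)); rewrite mem_atomics tn.
rewrite mem_atomics; case: f => // [t u|t u|t u|t tn|s t tn].
1-3: by case/andP=> tn un; have [] := H t u tn un.
  by have [] := H t t tn tn.
have [_ _ _ _ L] := H t t tn tn; exact: L.
Qed.

(** One round of the Ehrenfeucht-Fraisse game: equality of the two sets of realized types is the
    back-and-forth condition. *)
Lemma tpS k n M N (e : nat -> M) (e' : nat -> N) :
  tp k.+1 n e = tp k.+1 n e' <->
  (forall a, exists b, tp k n.+1 (upd e n a) = tp k n.+1 (upd e' n b)) /\
  (forall b, exists a, tp k n.+1 (upd e n a) = tp k n.+1 (upd e' n b)).
Proof.
split=> [E|[H1 H2]].
  split=> a.
    have /mem_tpS[b ab] : tp k n.+1 (upd e n a) \in (tp k.+1 n e' : {set _}).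
      by rewrite -E; apply/mem_tpS; exists a.
    by exists b.
  have /mem_tpS[b ab] : tp k n.+1 (upd e' n a) \in (tp k.+1 n e : {set _}).
    by rewrite E; apply/mem_tpS; exists a.
  by exists b.
apply/setP => t; apply/idP/idP => /mem_tpS[a <-]; apply/mem_tpS.
  by have [b ->] := H1 a; exists b.
by have [b <-] := H2 a; exists b.
Qed.

Lemma eval_upd_fresh n M (e : nat -> M) a t :
  t \in terms n -> eval_term (upd e n a) t = eval_term e t.
Proof. by rewrite mem_terms /upd; case: t => //= x; case: ltngtP. Qed.

Lemma terms_leS n t : t \in terms n -> t \in terms n.+1.
Proof. by rewrite !mem_terms; case: t => // x; apply: ltnW. Qed.

(** The remaining rounds are spent on an arbitrary move, here [s_bot M]; terms in the first [n]
    variables do not see it. *)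
Lemma tp_atomic k n M N (e : nat -> M) (e' : nat -> N) :
  tp k n e = tp k n e' -> atomic_equiv n e e'.
Proof.
elim: k n e e' => [|k IH] n e e'; first by move/tp0P.
move/tpS => [/(_ (s_bot M))[b /IH H] _] t u tn un.
have := H t u (terms_leS tn) (terms_leS un).
by rewrite !eval_upd_fresh.
Qed.

(** Bound variables of [f] have arbitrary names, possibly reused, while moves of the game are
    numbered consecutively. The substitution [v] translates the former into the latter: a quantifier
    on [x] becomes move number [n], and [v] is updated at [x]. *)
Lemma tp_sat k n M N (e : nat -> M) (e' : nat -> N) f (v : nat -> term) :
  tp k n e = tp k n e' -> depth f <= k -> (forall x, v x \in terms n) ->
  sat (eval_term e \o v) f <-> sat (eval_term e' \o v) f.
Proof.
pose w (v : nat -> term) t := if t is Var x then v x else Bot.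
have wn m v' t : (forall x, v' x \in terms m) -> w v' t \in terms m.
  by case: t => [x|] //= _; rewrite mem_terms.
have wE (K : structure Sigma) (d : nat -> K) v' t :
    eval_term (eval_term d \o v') t = eval_term d (w v' t).
  by case: t.
elim: f k n e e' v => [t u|t u|t u|t|s t||g IHg h IHh|x g IHg] k n e e' v eE fk vn.
1-3: by have [] := tp_atomic eE (wn _ _ t vn) (wn _ _ u vn); rewrite /= !wE.
1-2: by have [_ _ _ ? L] := tp_atomic eE (wn _ _ t vn) (wn _ _ t vn); rewrite /= !wE.
- by [].
- move: fk; rewrite /= geq_max => /andP[gk hk].
  by have := IHg k n e e' v eE gk vn; have := IHh k n e e' v eE hk vn; tauto.
- case: k eE fk => // k eE fk.
  have [v'n v'E] : (forall y, upd v x (Var n) y \in terms n.+1) /\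
      forall (K : structure Sigma) (d : nat -> K) (a : K),
        upd (eval_term d \o v) x a = eval_term (upd d n a) \o upd v x (Var n).
    split=> [y|K d a].
      by rewrite /upd; case: eqP => _; [rewrite mem_terms|apply: terms_leS].
    apply/funext => y; rewrite /upd /=; case: eqP => _ /=.
      by rewrite eqxx.
    by rewrite eval_upd_fresh.
  have [E1 E2] := (tpS k n e e').1 eE.
  split=> /= H a; rewrite v'E.
    by have [b /(IHg k n.+1) <-//] := E2 a; rewrite -v'E.
  by have [b /(IHg k n.+1) ->//] := E1 a; rewrite -v'E.
Qed.

(** Moves are answered in each component separately. The atomic case works because [Bot] is among
    the terms: the relations of the product test whether a component equals the bottom, and a rank-0
    type records this. *)
Lemma tp_otimes k n M M' N N' (e : nat -> otimes M N) (e' : nat -> otimes M' N') :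
  tp k n (fun i => (e i).1) = tp k n (fun i => (e' i).1) ->
  tp k n (fun i => (e i).2) = tp k n (fun i => (e' i).2) ->
  tp k n e = tp k n e'.
Proof.
have upd_fst (A B : structure Sigma) (d : nat -> otimes A B) i a :
    (fun j => (upd d i a j).1) = upd (fun j => (d j).1) i a.1.
  by apply/funext => j; rewrite /upd; case: eqP.
have upd_snd (A B : structure Sigma) (d : nat -> otimes A B) i a :
    (fun j => (upd d i a j).2) = upd (fun j => (d j).2) i a.2.
  by apply/funext => j; rewrite /upd; case: eqP.
elim: k n e e' => [|k IH] n e e'.
  move=> /tp0P E1 /tp0P E2; apply/tp0P => t u tn un.
  have evalE (A B : structure Sigma) (d : nat -> otimes A B) t' : eval_term d t' =
      (eval_term (fun i => (d i).1) t', eval_term (fun i => (d i).2) t').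
    by case: t' => //= x; case: (d x).
  have Bn : Bot \in terms n by rewrite mem_terms.
  rewrite !evalE.
  have [e1 s1 p1 a1 l1] := E1 t u tn un; have [e2 s2 p2 a2 l2] := E2 t u tn un.
  have [/= b1 _ _ _ _] := E1 t Bot tn Bn; have [/= b2 _ _ _ _] := E2 t Bot tn Bn.
  have [/= c1 _ _ _ _] := E1 u Bot un Bn; have [/= c2 _ _ _ _] := E2 u Bot un Bn.
  split=> /=.
  - split=> -[X Y]; congr pair; tauto.
  - tauto.
  - by split=> -[[? ?]|?|?]; [constructor 1|constructor 2|constructor 3
      |constructor 1|constructor 2|constructor 3]; tauto.
  - tauto.
  - by move=> s; have := l1 s; have := l2 s; tauto.
move=> /tpS[E1 E1'] /tpS[E2 E2']; apply/tpS; split=> -[a b].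
  have [a' aa'] := E1 a; have [b' bb'] := E2 b; exists (a', b').
  by apply: IH; rewrite ?upd_fst ?upd_snd.
have [a' aa'] := E1' a; have [b' bb'] := E2' b; exists (a', b').
by apply: IH; rewrite ?upd_fst ?upd_snd.
Qed.

Definition rank_type k M : tau k 0 := tp k 0 (fun=> s_bot M).

Lemma sat_hintikka0 k M (e : nat -> M) (t : tau k 0) :
  sat e (hintikka t) <-> rank_type k M = t.
Proof.
rewrite -sat_hintikka; split=> /sat_sentence; apply; exact: sentence_hintikka.
Qed.

(** The Hintikka sentence of [N] has depth at most [k], which gives one direction. The other is
    [tp_sat] with the constant substitution [Bot], harmless for sentences. *)
Lemma approxP k M N : approx k M N <-> rank_type k M = rank_type k N.
Proof.
split=> [H|E f sf fk].
  apply/esym/(sat_hintikka0 (fun=> s_bot N)).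
  apply: (H _ (sentence_hintikka _) (depth_hintikka _)).1 => e.
  exact/sat_hintikka0.
have := tp_sat E fk (v := fun=> Bot) (fun=> mem_head _ _).
rewrite (_ : _ \o _ = fun=> s_bot M) // (_ : _ \o _ = fun=> s_bot N) //.
by move=> H; split=> mf; apply: sat_sentence sf _; apply/H; apply: mf.
Qed.

Lemma approx_refl k M : approx k M M.
Proof. exact/approxP. Qed.

Lemma approx_sym k M N : approx k M N -> approx k N M.
Proof. by move/approxP => E; apply/approxP. Qed.

Lemma approx_trans k M N K : approx k M N -> approx k N K -> approx k M K.
Proof. by move=> /approxP E /approxP E'; apply/approxP; rewrite E. Qed.

Lemma approx_leq k k' M N : k <= k' -> approx k' M N -> approx k M N.
Proof. by move=> kk' H f sf fk; apply: H => //; apply: leq_trans fk kk'. Qed.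

Lemma approx_otimes k M M' N N' :
  approx k M M' -> approx k N N' -> approx k (otimes M N) (otimes M' N').
Proof. by move=> /approxP E /approxP E'; apply/approxP/tp_otimes. Qed.

(** Isomorphic structures agree at every rank. The isomorphism is given as a surjection that
    preserves and reflects all relations, so that no inverse has to be constructed. *)
Lemma approx_surj_embedding k M N (h : M -> N) :
  (forall b, exists a, h a = b) -> h (s_bot M) = s_bot N ->
  (forall a b, h a = h b -> a = b) ->
  (forall a b, s_sub (h a) (h b) <-> s_sub a b) ->
  (forall a b, s_prec (h a) (h b) <-> s_prec a b) ->
  (forall a, s_at (h a) <-> s_at a) ->
  (forall s a, s_lab s (h a) <-> s_lab s a) ->
  approx k M N.
Proof.
move=> hs h0 hi hsub hprec hat hlab f sf _.
suff H g (e : nat -> M) : sat e g <-> sat (h \o e) g.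
  by split=> mf; [apply: (sat_sentence (e := h \o fun=> s_bot M))
    |apply: (sat_sentence (e := fun=> s_bot M))] => //; apply/H; apply: mf.
elim: g e => [t u|t u|t u|t|s t||g IHg g' IHg'|x g IHg] e /=.
1-5: have hE t' : eval_term (h \o e) t' = h (eval_term e t') by case: t'.
1-5: rewrite !hE //.
- by split=> [->|/hi].
- by rewrite hsub.
- by rewrite hprec.
- by rewrite hat.
- by rewrite hlab.
- by [].
- by rewrite IHg IHg'.
- have updh a : h \o upd e x a = upd (h \o e) x (h a).
    by apply/funext => y; rewrite /upd /=; case: eqP.
  split=> H b; last by apply/IHg; rewrite updh; apply: H.
  by have [a <-] := hs b; rewrite -updh; apply/IHg; apply: H.
Qed.

End Types.

(** * Words *)

Section WordModels.
Context {Sigma : finType}.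
Implicit Types (u v w : seq Sigma).

Lemma pred_ext (T : Type) (A B : T -> Prop) : (forall a, A a <-> B a) -> A = B.
Proof. by move=> AB; apply/funext => a; apply/propext. Qed.

Lemma eq_inj (T : Type) (a b : T) : eq a = eq b -> a = b.
Proof. by move=> ->. Qed.

(** The atoms of [MSO w] are the predicates [eq a]. This rule and [prec_eqE] turn relations between
    atoms into relations between positions. *)
Lemma sub_eqE (T : Type) (a : T) (A : T -> Prop) : (forall b, a = b -> A b) = A a.
Proof. by apply/propext; split=> [|Aa b <-]; first apply. Qed.

Lemma prec_eqE (T : Type) (r : T -> nat) (a b : T) :
  (exists a' b', [/\ a = a', b = b' & r a' < r b']) = (r a < r b).
Proof. by apply/propext; split=> [[_ [_ [<- <-]]]|ab]; last by exists a, b. Qed.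

Lemma MSO_compr w (P : MSO w -> Prop) :
  exists Z : MSO w, forall a : MSO w, s_at a -> s_sub a Z <-> P a.
Proof.
by exists (fun a => P (eq a)) => _ [a ->]; rewrite /= sub_eqE.
Qed.

Lemma MSO_T w : models_all (MSO w) T_MSO.
Proof.
have pos_inj (a b : position w) : sval a = sval b -> a = b by exact: val_inj.
have neq_bot (A : MSO w) : A <> s_bot (MSO w) -> exists a, A a.
  move=> nA; apply: contrapT => /forallNP H; apply: nA; apply: pred_ext => a.
  by split=> // /H.
have at_neq (a : position w) : (eq a : MSO w) <> s_bot (MSO w).
  by move/(congr1 (@^~ a)) => /= E; rewrite -E.
have least (A : MSO w) a : A a -> exists2 b, A b & forall c, A c -> sval b <= sval c.
  move=> Aa; pose P i := `[< exists2 c, A c & sval c = i >].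
  have exP : exists i, P i by exists (sval a); apply/asboolP; exists a.
  case: (ex_minnP exP) => i /asboolP[b Ab <-] H; exists b => // c Ac.
  by apply: H; apply/asboolP; exists c.
have greatest (A : MSO w) a : A a -> exists2 b, A b & forall c, A c -> sval c <= sval b.
  move=> Aa; pose P i := `[< exists2 c, A c & sval c = i >].
  have exP : exists i, P i by exists (sval a); apply/asboolP; exists a.
  have leP i : P i -> i <= size w by case/asboolP => c _ <-; apply/ltnW/(svalP c).
  case: (ex_maxnP exP leP) => i /asboolP[b Ab <-] H; exists b => // c Ac.
  by apply: H; apply/asboolP; exists c.
move=> f [].
- by move=> e A a.
- move=> e A B AB BA; apply: pred_ext => a; split; [exact: AB|exact: BA].
- by move=> e A B C AB BC a /AB /BC.
- by move=> e A a.
- apply/models_Alls => e; set A := e 0; set B := e 1; rewrite satE; exists (fun a => A a \/ B a); rewrite /is_join !satE.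
  by split; [|split]; [left|right|move=> C AC BC a [/AC|/BC]].
- apply/models_Alls => e; set A := e 0; set B := e 1; rewrite satE; exists (fun a => A a /\ B a); rewrite /is_meet !satE.
  by split; [|split]; [move=> a []|move=> a []|move=> C CA CB a Ca; split; [apply: CA|apply: CB]].
- apply/models_Alls => e; set X0 := e 0; set X1 := e 1; set X2 := e 2; set X3 := e 3.
  set X4 := e 4; set X5 := e 5; set X6 := e 6.
  rewrite sat_Imp => J1; rewrite sat_Imp => J2; rewrite sat_Imp => J3; rewrite sat_Imp.
  move: J1 J2 J3; rewrite /is_join /is_meet !satE /= /upd /=.
  move=> [s13 [s23 l3]] [s40 [s43 g4]] [s50 [s51 g5]] [s60 [s62 g6]].
  split; [|split].
  + by apply: (g4 X5) => // a /s51 /s13.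
  + by apply: (g4 X6) => // a /s62 /s23.
  + move=> Y X5Y X6Y a X4a.
    (* Testing the least upper bound [X3] against the union of [X1] and [X2] puts the point in one
       of them; the intersections with [X0] then test [X5] and [X6]. *)
    have [X1a|X2a] := l3 (fun b => X1 b \/ X2 b)
      (fun b => @or_introl _ _) (fun b => @or_intror _ _) a (s43 a X4a).
      by apply: X5Y; apply: (g5 (fun b => X0 b /\ X1 b)) => [b []|b []|] //;
      split=> //; apply: s40.
    by apply: X6Y; apply: (g6 (fun b => X0 b /\ X2 b)) => [b []|b []|] //;
      split=> //; apply: s40.
- apply/models_All => e; set A := e 0; rewrite satE; exists (fun a => ~ A a); rewrite satE.
  exists (fun=> True); rewrite /is_top /is_meet /is_join !satE /= /upd /=.
  split; first by [].
  split.
    by split=> //; split; [move=> a []|move=> B BA BA' a Ba; apply: (BA' a) => //; apply: BA].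
  do 2!split=> //.
  by move=> B AB A'B a _; have [/AB|/A'B] := EM (A a).
- apply/models_All => e; rewrite !satE; split=> [[a E]|[/neq_bot[a Aa]]].
    have {}E : e 0 = eq a by [].
    split; first by rewrite /= E => /at_neq.
    rewrite sat_All => B; rewrite sat_Imp satE /= /upd /= E => Ba.
    have [Baa|nBa] := EM (B a).
      by right; apply: pred_ext => b; split=> [/Ba|<-].
    by left; apply: pred_ext => b; split=> // Bb; apply: nBa; rewrite (Ba _ Bb).
  rewrite sat_All => H; exists a; move: (H (eq a)); rewrite sat_Imp satE /= /upd /=.
  by case=> [b <-//|/at_neq//|->].
- apply/models_All => e; set A := e 0; rewrite sat_Imp !satE /= /upd /= => /neq_bot[a Aa].
  by exists (eq a); [exists a|rewrite /= => b <-].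
- by move=> e; rewrite satE => _ [a ->]; rewrite satE /= /upd /= prec_eqE ltnn.
- move=> e; rewrite satE => _ [a ->]; rewrite satE => _ [b ->]; rewrite satE => _ [c ->].
  by rewrite sat_Imp => H; rewrite sat_Imp; move: H; rewrite /= /upd /= !prec_eqE; apply: ltn_trans.
- move=> e; rewrite satE => _ [a ->]; rewrite satE => _ [b ->]; rewrite !satE /= /upd /=.
  rewrite !prec_eqE; case: ltngtP => [|?|/pos_inj ->]; [left|right; right|right; left] => //.
- move=> e; rewrite satE => _ [a ->]; rewrite sat_Imp satE.
  case=> _ [b ->] E; have {E} ab : sval a < sval b by move: E; rewrite /= /upd /= prec_eqE.
  have [c ac H] := least (fun c => sval a < sval c) b ab.
  rewrite satE; exists (eq c); first by exists c.
  rewrite !satE; split; first by rewrite /= /upd /= prec_eqE.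
  case=> _ [d ->]; rewrite satE /= /upd /= !prec_eqE => -[/H cd].
  by rewrite ltnNge cd.
- move=> e; rewrite satE => _ [a ->]; rewrite sat_Imp satE.
  case=> _ [b ->] E; have {E} ba : sval b < sval a by move: E; rewrite /= /upd /= prec_eqE.
  have [c ca H] := greatest (fun c => sval c < sval a) b ba.
  rewrite satE; exists (eq c); first by exists c.
  rewrite !satE; split; first by rewrite /= /upd /= prec_eqE.
  case=> _ [d ->]; rewrite satE /= /upd /= !prec_eqE => -[cd /H].
  by rewrite leqNgt cd.
- move=> e; rewrite sat_Imp !satE => -[_ [a _]].
  have [b _ H] := least (fun=> True) a I; exists (eq b); first by exists b.
  rewrite satE => _ [c ->]; rewrite satE /= /upd /= prec_eqE.
  by have := H c I; rewrite leq_eqVlt => /predU1P[/pos_inj ->|]; [left|right].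
- move=> e; rewrite sat_Imp !satE => -[_ [a _]].
  have [b _ H] := greatest (fun=> True) a I; exists (eq b); first by exists b.
  rewrite satE => _ [c ->]; rewrite satE /= /upd /= prec_eqE.
  by have := H c I; rewrite leq_eqVlt => /predU1P[/pos_inj ->|]; [left|right].
- apply/models_All => e; set A := e 0; rewrite sat_Imp !satE => /neq_bot[a].
  move=> /(least (e 0))[b Ab H]; exists (eq b); first by exists b.
  rewrite !satE; split; first by rewrite /= /upd /= sub_eqE.
  move=> _ [c ->]; rewrite sat_Imp satE /= /upd /=.
  by rewrite sub_eqE prec_eqE => /H; rewrite leq_eqVlt => /predU1P[/pos_inj ->|]; [left|right].
- apply/models_Alls => e; set A := e 0; set B := e 1; rewrite !satE; split=> [[a [b [Aa Bb ab]]]|[_ [a ->]]].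
    exists (eq a); first by exists a.
    rewrite satE; exists (eq b); first by exists b.
    by rewrite !satE /= /upd /= !sub_eqE prec_eqE.
  rewrite satE => -[_ [b ->]]; rewrite !satE /= /upd /= !sub_eqE prec_eqE => -[Aa [Bb ab]].
  by exists a, b.
- by move=> s e A [a]; exists a.
- move=> e; rewrite satE => _ [a ->]; apply/sat_bigOr; exists (Lab (letter a) 0).
    by apply/map_f; rewrite mem_enum.
  by exists a.
- move=> s s' ss'; apply/models_All => e; rewrite sat_Not sat_And => -[[a E la]].
  move/eqP: ss' => ss' [b Eb lb].
  by apply: ss'; rewrite -la -lb; congr letter; apply: eq_inj; rewrite -[eq a]E.
- move=> x z g xz zg; apply/models_Alls => e; rewrite satE.
  have [Z HZ] := MSO_compr (fun a => sat (upd e x a) g).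
  exists Z; rewrite satE => a ata.
  rewrite satE (_ : sat _ g = sat (upd e x a) g); last first.
    apply/propext/sat_ext => y yg; rewrite /upd; case: eqP => // _; case: eqP => // yz.
    by rewrite yz (negbTE zg) in yg.
  have zx : upd (upd e z Z) x a z = Z by rewrite /upd eq_sym (negbTE xz) eqxx.
  by rewrite -HZ // /sat /eval_term updE zx.
Qed.

(** A set of positions of [u ++ v] amounts to the pair of its traces on the two factors. The clause
    of [otimes] about elements other than the bottom accounts for a position of [u] preceding one of
    [v]. *)
Lemma MSO_cat k u v : approx k (MSO (u ++ v)) (otimes (MSO u) (MSO v)).
Proof.
have lt_l (a : position u) : sval a < size (u ++ v).
  by rewrite size_cat ltn_addr // (svalP a).
have lt_r (a : position v) : size u + sval a < size (u ++ v).
  by rewrite size_cat ltn_add2l (svalP a).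
pose l (a : position u) : position (u ++ v) := exist (fun i => i < size (u ++ v)) _ (lt_l a).
pose r (a : position v) : position (u ++ v) := exist (fun i => i < size (u ++ v)) _ (lt_r a).
have split_pos (a : position (u ++ v)) : (exists b, a = l b) \/ (exists b, a = r b).
  case: a => i ilt; have [iu|ui] := ltnP i (size u).
    by left; exists (exist (fun i => i < size u) i iu); apply: val_inj.
  have ilt' : i - size u < size v by rewrite ltn_subLR // -size_cat.
  by right; exists (exist (fun i => i < size v) _ ilt'); apply: val_inj; rewrite /= subnKC.
have l_inj : injective l by move=> a b /(congr1 sval) E; apply: val_inj.
have r_inj : injective r by move=> a b /(congr1 sval) /= /addnI E; apply: val_inj.
have lr a b : l a <> r b.
  by move/(congr1 sval) => /= E; have := svalP a; rewrite /= E ltnNge leq_addr.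
have letter_l a : letter (l a) = letter a.
  by rewrite /letter !(tnth_nth (letter a)) /= nth_cat (svalP a).
have letter_r a : letter (r a) = letter a.
  by rewrite /letter !(tnth_nth (letter a)) /= nth_cat ltnNge leq_addr /= addKn.
pose h (A : MSO (u ++ v)) : otimes (MSO u) (MSO v) := (A \o l, A \o r).
have hl a : h (eq (l a)) = (eq a, s_bot (MSO v)).
  congr pair; apply: pred_ext => b /=; first by split=> [/l_inj|->].
  by split=> // /lr.
have hr a : h (eq (r a)) = (s_bot (MSO u), eq a).
  congr pair; apply: pred_ext => b /=; last by split=> [/r_inj|->].
  by split=> // /esym/lr.
have h_inj A B : h A = h B -> A = B.
  move=> [E1 E2]; apply: pred_ext => a; case: (split_pos a) => -[b ->].
    by rewrite -[A _]/((A \o l) b) E1.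
  by rewrite -[A _]/((A \o r) b) E2.
apply: (@approx_surj_embedding _ _ (MSO (u ++ v)) (otimes (MSO u) (MSO v)) h) => //.
- move=> [A B]; exists (fun a => (exists2 b, a = l b & A b) \/ (exists2 b, a = r b & B b)).
  congr pair; apply: pred_ext => a /=; split.
  + by case=> -[b]; [move=> /l_inj ->|move=> /lr].
  + by move=> Aa; left; exists a.
  + by case=> -[b]; [move=> /esym/lr|move=> /r_inj ->].
  + by move=> Ba; right; exists a.
- move=> A B; split=> [[H1 H2] a|AB]; last by split=> a; apply: AB.
  by case: (split_pos a) => -[b ->]; [apply: H1|apply: H2].
- move=> A B; split.
    have nbot w (C : MSO w) : C <> s_bot (MSO w) -> exists c, C c.
      move=> nC; apply: contrapT => /forallNP H; apply: nC; apply: pred_ext => c.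
      by split=> // /H.
    case=> [[/nbot[a Aa] /nbot[b Bb]]|[a [b [Aa Bb ab]]]|[a [b [Aa Bb ab]]]].
    + by exists (l a), (r b); split=> //=; apply: leq_trans (svalP a) (leq_addr _ _).
    + by exists (l a), (l b).
    + by exists (r a), (r b); split=> //=; rewrite ltn_add2l.
  have nbot w (C : MSO w) c : C c -> C <> s_bot (MSO w) by move=> Cc E; rewrite E in Cc.
  case=> a [b [+ + +]]; case: (split_pos a) => -[a' ->]; case: (split_pos b) => -[b' ->] Aa Bb /=.
  + by constructor 2; exists a', b'.
  + by constructor 1; split; [apply: (nbot _ _ a')|apply: (nbot _ _ b')].
  + by rewrite ltnNge (leq_trans (ltnW (svalP b')) (leq_addr _ _)).
  + by rewrite ltn_add2l => ab; constructor 3; exists a', b'.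
- move=> A; split.
    by case=> -[]; [move=> [a Aa] A0|move=> A0 [a Aa]];
      [exists (l a)|exists (r a)]; apply: h_inj; rewrite ?hl ?hr; congr pair.
  case=> a ->; case: (split_pos a) => -[b ->]; rewrite ?hl ?hr; [left|right];
    by split=> //; exists b.
- move=> s A; split.
    by case=> -[]; [move=> [a Aa <-] A0|move=> A0 [a Aa <-]];
      [exists (l a)|exists (r a)]; rewrite ?letter_l ?letter_r //;
      apply: h_inj; rewrite ?hl ?hr; congr pair.
  case=> a -> <-; case: (split_pos a) => -[b ->];
    rewrite ?hl ?hr ?letter_l ?letter_r; [left|right];
    by split=> //; exists b.
Qed.

End WordModels.

(** * Models of T *)

Section Relativization.
Context {Sigma : finType}.
Implicit Types (M : structure Sigma) (f g : formula Sigma).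

Definition restr M (Y : M) (botY : s_sub (s_bot M) Y) : structure Sigma :=
  {| dom := {X : M | s_sub X Y};
     s_sub := fun A B => s_sub (sval A) (sval B);
     s_prec := fun A B => s_prec (sval A) (sval B);
     s_at := fun A => s_at (sval A);
     s_bot := exist (fun X => s_sub X Y) _ botY;
     s_lab := fun s A => s_lab s (sval A) |}.

Lemma restr_inj M (Y : M) (botY : s_sub (s_bot M) Y) (A B : restr botY) :
  sval A = sval B -> A = B.
Proof.
by case: A B => A pA [B pB] /= E; move: pA; rewrite E => pA; congr exist; apply: Prop_irrelevance.
Qed.

(** Bound variables are collected too: [relativize] inserts [y] under every quantifier, so freshness
    for free variables alone would allow capture. *)
Fixpoint vars f : seq nat :=
  match f with
  | Eq t u | Sub t u | Prec t u => fv_term t ++ fv_term u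
  | At t | Lab _ t => fv_term t
  | Fls => [::]
  | Imp g h => vars g ++ vars h
  | All x g => x :: vars g
  end.

Fixpoint relativize (y : nat) f : formula Sigma :=
  match f with
  | Imp g h => Imp (relativize y g) (relativize y h)
  | All x g => All x (Imp (Sub x y) (relativize y g))
  | _ => f
  end.

Lemma sat_relativize M (Y : M) (botY : s_sub (s_bot M) Y) y f
    (e : nat -> restr botY) (d : nat -> M) :
  y \notin vars f -> d y = Y -> {in fv f, forall x, d x = sval (e x)} ->
  sat e f <-> sat d (relativize y f).
Proof.
have evE t (e' : nat -> restr botY) (d' : nat -> M) :
    {in fv_term t, forall x, d' x = sval (e' x)} ->
    eval_term d' t = sval (eval_term e' t).
  by case: t => [x|] //= H; apply: H; rewrite mem_head.
elim: f e d => [t u|t u|t u|t|s t||g IHg h IHh|x g IHg] e d /= yf dy de.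
1-3: rewrite !(evE _ e) => [|x xu|x xt]; try by apply: de; rewrite mem_cat ?xu ?xt ?orbT.
4-5: by rewrite (evE _ e).
- by split=> [->|/restr_inj].
- by [].
- by [].
- by [].
- move: yf; rewrite mem_cat negb_or => /andP[yg yh].
  rewrite (IHg e d) ?(IHh e d) // => x xf; apply: de; rewrite mem_cat xf ?orbT //.
- move: yf; rewrite inE negb_or => /andP[yx yg].
  have step a aY : sat (upd e x (exist (fun X => s_sub X Y) a aY)) g <->
      sat (upd d x a) (relativize y g).
    apply: IHg => //; first by rewrite /upd (negbTE yx).
    move=> z zg; rewrite /upd; case: eqVneq => // zx; apply: de.
    by rewrite mem_filter zx.
  rewrite /upd eqxx (negbTE yx) dy -/(upd d x _).
  by split=> [H a aY|H [a aY]]; [apply/(step a aY); apply: H|apply/step; apply: H].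
Qed.

(** The disjunction runs over the types realized by words, not over the words, and is therefore
    finite. *)
Definition wordlike k : formula Sigma :=
  bigOr [seq hintikka t | t <- enum [pred t : tau k 0 | `[< exists w, rank_type k (MSO w) = t >]]].

Lemma sat_wordlike k M (e : nat -> M) :
  sat e (wordlike k) <-> exists w, approx k M (MSO w).
Proof.
rewrite sat_bigOr; split=> [[f /mapP[t + ->]]|[w /approxP Mw]].
  rewrite mem_enum inE => -[w wt] /sat_hintikka0 Mt.
  by exists w; apply/approxP; rewrite Mt.
exists (hintikka (rank_type k M)); last exact/sat_hintikka0.
by apply/map_f; rewrite mem_enum inE; exists w.
Qed.

Lemma sentence_wordlike k : sentence (wordlike k).
Proof.
have := @fv_bigOr Sigma pred0 [seq hintikka t | t <- enum
  [pred t : tau k 0 | `[< exists w, rank_type k (MSO w) = t >]]].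
rewrite -/(wordlike k) /sentence; case: (fv _) => // x s H.
suff // : all pred0 (x :: s) by [].
by apply: H => f /mapP[t _ ->]; rewrite sentence_hintikka.
Qed.

End Relativization.

(** * Consequences of the axioms, and equivalence of models with words *)

Section ModelsOfT.
Context {Sigma : finType}.
Variable M : structure Sigma.
Hypothesis MT : models_all M T_MSO.
Implicit Types (f : formula Sigma) (X Y a b : M).

Let env (s : seq M) : nat -> M := nth (s_bot M) s.

Let T_sat f (s : seq M) xs : T_MSO (Alls xs f) -> sat (env s) f.
Proof. by move=> /MT/models_Alls; apply. Qed.

Lemma subM_refl X : s_sub X X.
Proof. exact: (T_sat [:: X] (xs := [:: 0]) (T_refl (Sigma := Sigma))). Qed.

Lemma subM_trans X Y Z : s_sub X Y -> s_sub Y Z -> s_sub X Z.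
Proof. exact: (T_sat [:: X; Y; Z] T_trans). Qed.

Lemma subM_anti X Y : s_sub X Y -> s_sub Y X -> X = Y.
Proof. exact: (T_sat [:: X; Y] T_antisym). Qed.

Lemma botM X : s_sub (s_bot M) X.
Proof. exact: (T_sat [:: X] (xs := [:: 0]) T_bot). Qed.

Lemma atM a : s_at a <-> a <> s_bot M /\ forall X, s_sub X a -> X = s_bot M \/ X = a.
Proof.
have := T_sat [:: a] (xs := [:: 0]) T_at.
rewrite !satE => -[H1 H2]; split=> [/H1[a0 H]|[a0 H]].
  split=> // X; move: H; rewrite sat_All => /(_ X); rewrite sat_Imp sat_Or /= /upd /=; exact.
by apply: H2; split=> //; rewrite sat_All => X; rewrite sat_Imp sat_Or; apply: H.
Qed.

Lemma at_neq_bot a : s_at a -> a <> s_bot M.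
Proof. by case/atM. Qed.

Lemma sub_at a b : s_at a -> s_at b -> s_sub a b -> a = b.
Proof. by move=> /at_neq_bot a0 /atM[_ H] /H[/a0|]. Qed.

Lemma at_not_sub_bot a : s_at a -> ~ s_sub a (s_bot M).
Proof. by move=> /at_neq_bot a0 ab; apply: a0; apply: subM_anti ab (botM _). Qed.

Lemma atomicM X : X <> s_bot M -> exists2 a, s_at a & s_sub a X.
Proof.
move=> X0; have := T_sat [:: X] (xs := [:: 0]) T_atomic.
by rewrite sat_Imp sat_ExAt; apply.
Qed.

Let joinP Z X Y := s_sub X Z /\ s_sub Y Z /\
  forall W, s_sub X W -> s_sub Y W -> s_sub Z W.

Let meetP Z X Y := s_sub Z X /\ s_sub Z Y /\
  forall W, s_sub W X -> s_sub W Y -> s_sub W Z.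

Let eval_upd9 (e : nat -> M) W t : t <> Var 9 -> eval_term (upd e 9 W) t = eval_term e t.
Proof. by case: t => //= x; rewrite /upd; case: eqP => // ->. Qed.

Let sat_is_join e (s t u : term) : s <> Var 9 -> t <> Var 9 -> u <> Var 9 ->
  sat e (is_join s t u) = joinP (eval_term e s) (eval_term e t) (eval_term e u).
Proof.
move=> s9 t9 u9; rewrite /is_join !sat_And sat_All /joinP.
congr (_ /\ (_ /\ _)); apply/propext; split=> H W; have := H W;
by rewrite /= !eval_upd9 // updE.
Qed.

Let sat_is_meet e (s t u : term) : s <> Var 9 -> t <> Var 9 -> u <> Var 9 ->
  sat e (is_meet s t u) = meetP (eval_term e s) (eval_term e t) (eval_term e u).
Proof.
move=> s9 t9 u9; rewrite /is_meet !sat_And sat_All /meetP.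
congr (_ /\ (_ /\ _)); apply/propext; split=> H W; have := H W;
by rewrite /= !eval_upd9 // updE.
Qed.

Lemma meetM X Y : exists m, meetP m X Y.
Proof.
have := T_sat [:: X; Y] T_meet.
by rewrite sat_Ex => -[m]; rewrite sat_is_meet // => ?; exists m.
Qed.

(** If [Y'] is a complement of [Y], the meet of [X] and [Y'] lies above no atom, hence is the
    bottom; by distributivity [X] is then the meet of [X] and [Y]. From here on, elements can be
    handled as sets of atoms. *)
Lemma sub_atoms X Y : (forall a, s_at a -> s_sub a X -> s_sub a Y) -> s_sub X Y.
Proof.
move=> XY.
have := T_sat [:: Y] (xs := [:: 0]) T_compl.
rewrite sat_Ex => -[Y']; rewrite sat_Ex => -[top].
rewrite 2!sat_And sat_is_meet // sat_is_join // /is_top sat_All /= /upd /=.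
move=> [topg [[_ [_ Y'g]] topj]].
have [m [mX [mY' mg]]] := meetM X Y'.
have m0 : m = s_bot M.
  apply: contrapT => /atomicM[a ata am].
  apply: (at_not_sub_bot ata); apply: Y'g; last exact: subM_trans am mY'.
  by apply: XY => //; apply: subM_trans am mX.
have [n [nX [nY ng]]] := meetM X Y.
(* The fifth entry is [X] again, in its role as the meet of [X] and [top]. *)
have := T_sat [:: X; Y; Y'; top; X; n; m] T_distr.
rewrite sat_Imp sat_is_join // sat_Imp sat_is_meet // sat_Imp sat_is_meet //.
rewrite sat_Imp sat_is_meet // sat_is_join //= => H.
have Xtop : meetP X X top by split; [exact: subM_refl|split].
have [_ [_ H']] := H topj Xtop (conj nX (conj nY ng)) (conj mX (conj mY' mg)).
apply: subM_trans nY; apply: H'; first exact: subM_refl.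
by rewrite m0; apply: botM.
Qed.

Lemma atoms_ext X Y : (forall a, s_at a -> s_sub a X <-> s_sub a Y) -> X = Y.
Proof. by move=> H; apply: subM_anti; apply: sub_atoms => a ata; apply H. Qed.

Lemma prec_irreflM a : s_at a -> ~ s_prec a a.
Proof. by have := MT T_prec_irrefl (fun=> s_bot M); rewrite satE; apply. Qed.

Lemma prec_transM a b c : s_at a -> s_at b -> s_at c ->
  s_prec a b -> s_prec b c -> s_prec a c.
Proof.
have := MT T_prec_trans (fun=> s_bot M); rewrite satE => + ata => /(_ a ata).
rewrite satE => + atb => /(_ b atb); rewrite satE => + atc => /(_ c atc).
exact.
Qed.

Lemma prec_totalM a b : s_at a -> s_at b -> [\/ s_prec a b, a = b | s_prec b a].
Proof.
have := MT T_prec_total (fun=> s_bot M); rewrite satE => + ata => /(_ a ata).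
rewrite satE => + atb => /(_ b atb); rewrite !satE /= /upd /=.
by case=> [|[]]; [constructor 1|constructor 2|constructor 3].
Qed.

Lemma predM a : s_at a -> (exists2 b : M, s_at b & s_prec b a) ->
  exists b : M, [/\ s_at b, s_prec b a & forall c, s_at c -> s_prec c a -> c = b \/ s_prec c b].
Proof.
have := MT T_pred (fun=> s_bot M); rewrite satE => + ata => /(_ a ata).
rewrite sat_Imp !sat_ExAt => H /H[b atb]; rewrite sat_And sat_Not sat_ExAt => -[ba nex].
exists b; split=> // c atc ca; have [?|->|bc] := prec_totalM atc atb; [by right|by left|].
by case: nex; exists c => //; rewrite sat_And.
Qed.

Lemma greatestM : (exists a, s_at a) ->
  exists2 b : M, s_at b & forall c, s_at c -> c = b \/ s_prec c b.
Proof.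
have := MT T_greatest (fun=> s_bot M); rewrite sat_Imp sat_Ex sat_ExAt => H /H[b atb].
rewrite sat_AllAt => gb; exists b => // c atc; have := gb c atc.
by rewrite sat_Or /= /upd /=; case; [left|right].
Qed.

Lemma least_belowM X : X <> s_bot M -> exists b : M, [/\ s_at b, s_sub b X &
  forall c, s_at c -> s_sub c X -> b = c \/ s_prec b c].
Proof.
move=> X0; have := T_sat [:: X] (xs := [:: 0]) T_least_below.
rewrite sat_Imp sat_ExAt => -[//|b atb]; rewrite sat_And sat_AllAt => -[bX lb].
by exists b; split=> // c atc; have := lb c atc; rewrite sat_Imp sat_Or.
Qed.

Lemma precM X Y : s_prec X Y <->
  exists a b : M, [/\ s_at a, s_at b, s_sub a X, s_sub b Y & s_prec a b].
Proof.
have := T_sat [:: X; Y] T_prec; rewrite sat_Iff sat_ExAt => H.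
split=> [/(H.1 : s_prec X Y -> _)[a ata]|[a [b [ata atb aX bY ab]]]].
  by rewrite sat_ExAt => -[b atb]; rewrite !sat_And => -[aX [bY ab]]; exists a, b.
by apply: H.2; exists a => //; rewrite sat_ExAt; exists b => //; rewrite !sat_And.
Qed.

Lemma lab_atM s a : s_lab s a -> s_at a.
Proof. exact: (T_sat [:: a] (xs := [:: 0]) (T_lab_at s)). Qed.

Lemma labM a : s_at a -> exists s, s_lab s a.
Proof.
move=> ata; have := MT T_lab_cover (fun=> s_bot M); rewrite satE => /(_ a ata).
by move/sat_bigOr => -[f /mapP[s _ ->]]; exists s.
Qed.

Lemma lab_injM s s' a : s_lab s a -> s_lab s' a -> s = s'.
Proof.
move=> sa s'a; apply/eqP/contraT => /T_lab_disj D.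
by have := T_sat [:: a] (xs := [:: 0]) D; rewrite sat_Not sat_And => -[].
Qed.

(** The variable [z] of the schema is taken larger than [x] and than every free variable of [f]; the
    parameters are the values of [e]. *)
Lemma comprM f (e : nat -> M) x :
  exists Z, forall a, s_at a -> s_sub a Z <-> sat (upd e x a) f.
Proof.
pose z := (x + \max_(y <- fv f) y).+1.
have xz : x != z by rewrite neq_ltn /z ltnS leq_addr.
have zf : z \notin fv f.
  apply/negP => zf; have : z <= \max_(y <- fv f) y.
    by rewrite (big_rem z) //= leq_maxl.
  by rewrite /z leqNgt ltnS leq_addl.
have /models_Alls/(_ e) := MT (T_compr xz zf); rewrite sat_Ex => -[Z].
rewrite sat_AllAt => H; exists Z => a ata; have := H a ata; rewrite sat_Iff /=.
rewrite updE {1}/upd eq_sym (negbTE xz) updE => ->.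
apply: sat_ext => y yf; rewrite /upd; case: eqP => // _; case: eqP => // yz.
by rewrite yz (negbTE zf) in yf.
Qed.

(** Splitting off the last atom [a]: an element below [Y] is determined by its meet with [Y'] and by
    whether it contains [a], and every such pair of data occurs. *)
Lemma restr_snoc k Y (botY : s_sub (s_bot M) Y) Y' (botY' : s_sub (s_bot M) Y') a s :
  s_at a -> s_lab s a ->
  (forall b, s_at b -> s_sub b Y <-> s_sub b Y' \/ b = a) ->
  (forall b, s_at b -> s_sub b Y' -> s_prec b a) ->
  approx k (restr botY) (otimes (restr botY') (MSO [:: s])).
Proof.
move=> ata sa YE Y'a.
have /choice[m mP] X : exists Z, forall b, s_at b -> s_sub b Z <-> s_sub b X /\ s_sub b Y'.
  have [Z [ZX [ZY' Zg]]] := meetM X Y'; exists Z => b atb.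
  by split=> [bZ|[bX bY']]; [split; apply: subM_trans bZ _|apply: Zg].
have mY' X : s_sub (m X) Y' by apply: sub_atoms => b atb /mP -/(_ atb)[].
pose p : position [:: s] := exist (fun i => i < 1) 0 isT.
have pE (q : position [:: s]) : q = p by case: q => [[|i] ilt] //; apply: val_inj.
have anY' : ~ s_sub a Y' by move=> /(Y'a a ata)/(prec_irreflM ata).
have aY : s_sub a Y by apply/YE => //; right.
have Y'Y : s_sub Y' Y by apply: sub_atoms => b atb bY'; apply/YE => //; left.
pose h (X : restr botY) : otimes (restr botY') (MSO [:: s]) :=
  (exist (fun X => s_sub X Y') (m (sval X)) (mY' _), fun=> s_sub a (sval X)).
have subY (A : restr botY) b : s_at b -> s_sub b (sval A) -> s_sub b Y' \/ b = a.
  by move=> atb bA; apply/YE => //; apply: subM_trans bA (svalP A).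
have sub_h (A B : restr botY) :
    s_sub (m (sval A)) (m (sval B)) -> (s_sub a (sval A) -> s_sub a (sval B)) ->
    s_sub (sval A) (sval B).
  move=> AB aAB; apply: sub_atoms => b atb bA.
  have [bY'|ba] := subY _ _ atb bA; last by rewrite ba in bA *; apply: aAB.
  have /mP -/(_ atb)[] // : s_sub b (m (sval B)).
  by apply: subM_trans AB; apply/mP.
have h_inj (A B : restr botY) : m (sval A) = m (sval B) ->
    (s_sub a (sval A) <-> s_sub a (sval B)) -> A = B.
  move=> E aAB; apply: restr_inj; apply: subM_anti; apply: sub_h; try apply aAB.
    by rewrite E; apply: subM_refl.
  by rewrite -E; apply: subM_refl.
have bot_m X : m X = s_bot M <-> forall b, s_at b -> s_sub b X -> ~ s_sub b Y'.
  split=> [E b atb bX bY'|H].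
    by apply: (at_not_sub_bot atb); rewrite -E; apply/mP.
  apply: contrapT => /atomicM[b atb /mP -/(_ atb)[bX bY']]; exact: H bY'.
have lab_p : letter p = s by rewrite /letter (tnth_nth s).
have pred_p (P : position [:: s] -> Prop) : P p -> P = eq p.
  by move=> Pp; apply: pred_ext => q; rewrite (pE q).
have at_m (A : restr botY) : s_at (m (sval A)) -> ~ s_sub a (sval A) -> sval A = m (sval A).
  move=> _ naA; apply: atoms_ext => b atb; rewrite mP //; split=> [bA|[]//].
  by split=> //; have [//|ba] := subY _ _ atb bA; rewrite ba in bA.
have at_a (A : restr botY) : m (sval A) = s_bot M -> s_sub a (sval A) -> sval A = a.
  move=> /bot_m mA aA; apply: atoms_ext => b atb; split=> [bA|/(sub_at atb ata) -> //].
  by have [/(mA _ atb bA)//|->] := subY _ _ atb bA; apply: subM_refl.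
have m_at b : s_at b -> s_sub b Y' -> m b = b.
  move=> atb bY'; apply: atoms_ext => c atc; rewrite mP //; split=> [[]//|cb].
  by split=> //; apply: subM_trans cb bY'.
have m_a : m a = s_bot M by apply/bot_m => b atb /(sub_at atb ata) ->.
apply: (@approx_surj_embedding _ _ (restr botY) (otimes (restr botY') (MSO [:: s])) h).
- move=> [[X XY'] P].
  have [Z ZP] : exists Z, forall b, s_at b -> s_sub b Z <-> s_sub b X \/ b = a /\ P p.
    have [Pp|nPp] := EM (P p).
      (* This adjoins [a] to [X]. Variable 0 is overwritten by the tested atom, so the first entry
         of the list is a placeholder. *)
      have [Z ZP] := comprM (Or (Sub 0 1) (Eq 0 2)) (env [:: X; X; a]) 0.
      by exists Z => b atb; rewrite ZP // sat_Or /= /upd /=; tauto.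
    by exists X => b _; tauto.
  have ZY : s_sub Z Y.
    apply: sub_atoms => b atb /ZP -/(_ atb)[bX|[-> _]]; last exact: aY.
    by apply: subM_trans Y'Y; apply: subM_trans XY'.
  exists (exist _ Z ZY); congr pair.
    apply: restr_inj => /=; apply: atoms_ext => b atb; rewrite mP // ZP //.
    split=> [[[//|[-> _]]]|bX]; first by move/anY'.
    by split; [left|apply: subM_trans bX XY'].
  apply: pred_ext => q; rewrite (pE q) ZP //; split=> [[aX|[]//]|Pp]; last by right.
  by case: anY'; apply: subM_trans aX XY'.
- congr pair; first by apply: restr_inj; apply/bot_m => b /= /at_not_sub_bot.
  by apply: pred_ext => q; split=> // /(at_not_sub_bot ata).
- move=> A B [E1 E2]; apply: h_inj => //.
  by have := congr1 (@^~ p) E2 => /= ->.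
- move=> A B; split=> [[/= mAB aAB]|AB].
    by apply: sub_h => // aA; apply: (aAB p).
  split=> /=; last by move=> _ aA; apply: subM_trans aA AB.
  apply: sub_atoms => b atb /mP -/(_ atb)[bA bY']; apply/mP => //; split=> //.
  exact: subM_trans bA AB.
- move=> A B; split.
    case=> /=.
    + move=> [mA0 mB0].
      have [b atb bm] : exists2 b : M, s_at b & s_sub b (m (sval A)).
        by apply: atomicM => E; apply: mA0; apply: restr_inj.
      have [bA bY'] := (mP _ _ atb).1 bm.
      apply/precM; exists b, a; split=> //; last exact: Y'a.
      apply: contrapT => naB; apply: mB0; apply: pred_ext => q; split=> //.
    + move=> /precM[b [c [atb atc /mP -/(_ atb)[bA _] /mP -/(_ atc)[cB _] bc]]].
      by apply/precM; exists b, c.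
    + by move=> [q [q' [_ _]]]; rewrite (pE q) (pE q').
  move=> /precM[b [c [atb atc bA cB bc]]].
  (* The atom [a] precedes no atom below [Y], so the smaller atom [b] cannot be [a]. *)
  have bY' : s_sub b Y'.
    have [//|ba] := subY _ _ atb bA; case: (prec_irreflM ata).
    have [cY'|ca] := subY _ _ atc cB; last by rewrite ba ca in bc.
    by rewrite {1}ba in bc; apply: prec_transM (Y'a _ atc cY').
  have [cY'|ca] := subY _ _ atc cB.
    by constructor 2; apply/precM; exists b, c; split=> //; apply/mP.
  constructor 1; split=> /=.
    by move/(congr1 sval) => /= /bot_m/(_ b atb bA).
  by move/(congr1 (@^~ p)) => /= E; rewrite -E -ca.
- move=> A; split.
    case=> -[/= H1 H2].
      have naA : ~ s_sub a (sval A) by move/(congr1 (@^~ p)): H2 => /= ->.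
      by rewrite /= at_m.
    have mA : m (sval A) = s_bot M by move/(congr1 sval): H1.
    case: H2 => q /(congr1 (@^~ q)) /= aA.
    by rewrite at_a //; rewrite aA.
  move=> /= atA; have [AY'|Aa] := subY _ _ atA (subM_refl _).
    left; rewrite /= m_at //; split=> //; apply: pred_ext => q; split=> // aA.
    by apply: anY'; rewrite (sub_at ata atA aA).
  right; rewrite /= Aa; split; first by apply: (@restr_inj _ _ _ botY'); exact: m_a.
  by exists p; apply: pred_p; apply: subM_refl.
- move=> t A; split.
    case=> -[/= H1 H2].
      have naA : ~ s_sub a (sval A) by move/(congr1 (@^~ p)): H2 => /= ->.
      by rewrite at_m //; apply: lab_atM H1.
    have mA : m (sval A) = s_bot M by move/(congr1 sval): H1.
    case: H2 => q /(congr1 (@^~ q)) /= aA <-.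
    by rewrite at_a ?(pE q) ?lab_p // aA.
  move=> /= tA; have atA := lab_atM tA.
  have [AY'|Aa] := subY _ _ atA (subM_refl _).
    left; rewrite /= m_at //; split=> //; apply: pred_ext => q; split=> // aA.
    by apply: anY'; rewrite (sub_at ata atA aA).
  right; rewrite /= Aa; split; first by apply: (@restr_inj _ _ _ botY'); exact: m_a.
  exists p; first by apply: pred_p; apply: subM_refl.
  by rewrite lab_p; apply: lab_injM sa _; rewrite -Aa.
Qed.

Lemma restr_bot k Y (botY : s_sub (s_bot M) Y) : Y = s_bot M ->
  approx k (restr botY) (MSO [::]).
Proof.
move=> Y0; have E (A : restr botY) : A = s_bot (restr botY).
  apply: restr_inj => /=; apply: subM_anti (botM _).
  by apply: subM_trans (svalP A) _; rewrite Y0; apply: subM_refl.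
have pos0 (q : position (Sigma := Sigma) [::]) : False by case: q.
have nat0 : ~ s_at (s_bot M) by move/at_not_sub_bot; apply; apply: subM_refl.
apply: (@approx_surj_embedding _ _ (restr botY) (MSO [::]) (fun=> s_bot (MSO [::]))) => //.
- by move=> P; exists (s_bot (restr botY)); apply: pred_ext => q; case: (pos0 q).
- by move=> A B; rewrite (E A) (E B).
- by move=> A B; rewrite (E A) (E B); split=> _; [exact: (subM_refl (s_bot M))|by []].
- move=> A B; rewrite (E A) (E B); split=> [[q]|/precM[b [_ [atb _ /(at_not_sub_bot atb)]]]//].
  by case: (pos0 q).
- by move=> A; rewrite (E A); split=> [[q]|/nat0//]; case: (pos0 q).
- by move=> s A; rewrite (E A); split=> [[q]|/lab_atM/nat0//]; case: (pos0 q).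
Qed.

Lemma restr_top k Y (botY : s_sub (s_bot M) Y) : (forall X, s_sub X Y) ->
  approx k (restr botY) M.
Proof.
move=> top; apply: (@approx_surj_embedding _ _ (restr botY) M sval) => //.
  by move=> X; exists (exist _ X (top X)).
by move=> A B; apply: restr_inj.
Qed.

(* Least counterexample: comprehension applies to the relativized formula
   saying that the prefix ending at [x] is [k]-equivalent to a word. *)
Lemma prefix_wordlike k a Y (botY : s_sub (s_bot M) Y) : s_at a ->
  (forall b, s_at b -> s_sub b Y <-> s_prec b a \/ b = a) ->
  exists w, approx k (restr botY) (MSO w).
Proof.
pose good Y := forall botY : s_sub (s_bot M) Y, exists w, approx k (restr botY) (MSO w).
pose isprefix a Y := forall b, s_at b -> s_sub b Y <-> s_prec b a \/ b = a.
suff H c : s_at c -> forall Z, isprefix c Z -> good Z by move=> ata /H; apply.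
(* The offset 2, rather than 1, also keeps [y] apart from the variables 0 and 1 used in [f]. *)
pose y := (\max_(z <- vars (wordlike k : formula Sigma)) z).+2.
have y_fresh : y \notin vars (wordlike k : formula Sigma).
  apply/negP => yf; have : y <= \max_(z <- vars (wordlike k : formula Sigma)) z.
    by rewrite (big_rem y) //= leq_maxl.
  by rewrite /y ltnNge ltnW.
(* Variable 0 is the end of the prefix, [y] the prefix and 1 a member of it. The formula defines the
   bad atoms, those with a prefix equivalent to no word. *)
pose f : formula Sigma := Not (All y (Imp (AllAt 1 (Iff (Sub 1 y) (Or (Prec 1 0) (Eq 1 0))))
   (relativize y (wordlike k)))).
have [Z ZP] := comprM f (env [::]) 0.
have prefE b V d : sat (upd (upd (upd (env [::]) 0 b) y V) 1 d)
    (Iff (Sub 1 y) (Or (Prec 1 0) (Eq 1 0))) = (s_sub d V <-> s_prec d b \/ d = b).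
  have [y0 y1] : (0 == y) = false /\ (y == 1) = false by [].
  by rewrite sat_Iff sat_Or /= /upd /= ?y0 ?y1 ?eqxx.
have {}ZP b : s_at b -> s_sub b Z <-> ~ forall Y, isprefix b Y -> good Y.
  move=> atb; rewrite ZP // sat_Not sat_All; split=> N H; apply: N => V.
    rewrite sat_Imp sat_AllAt => VP.
    have /H VG : isprefix b V.
      by move=> d atd; rewrite -prefE; apply: VP.
    have /sat_wordlike := VG (botM V) => /(_ (fun=> s_bot (restr (botM V)))).
    move/(sat_relativize (d := upd (upd (env [::]) 0 b) y V) y_fresh); apply.
      by rewrite updE.
    by move=> x; rewrite sentence_wordlike.
  move=> VP botV; apply/(sat_wordlike k (fun=> s_bot (restr botV))).
  apply/(sat_relativize (d := upd (upd (env [::]) 0 b) y V) y_fresh).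
  - by rewrite updE.
  - by move=> x; rewrite sentence_wordlike.
  have := H V; rewrite sat_Imp sat_AllAt; apply=> d atd.
  by rewrite prefE; apply: VP.
(* Without bad atoms the claim holds at [c]. Otherwise a contradiction is sought at the least bad
   atom [b]. *)
have [Z0|/least_belowM[b [atb bZ lb]]] := EM (Z = s_bot M).
  move=> atc; apply: contrapT => /ZP -/(_ atc); rewrite Z0.
  exact: at_not_sub_bot.
case: ((ZP b atb).1 bZ) => Y1 Y1P botY1.
have [s sb] := labM atb.
have [Y2 Y2P] := comprM (Prec 0 1) (env [:: b; b]) 0.
have {}Y2P d : s_at d -> s_sub d Y2 <-> s_prec d b by move=> atd; rewrite Y2P.
(* The strict prefix [Y2] is empty, or it ends at the immediate predecessor of [b], which is good by
   minimality; this is where discreteness enters. *)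
have [w wP] : exists w, approx k (restr (botM Y2)) (MSO w).
  have [Y20|/atomicM[d atd /Y2P -/(_ atd) db]] := EM (Y2 = s_bot M).
    by exists [::]; apply: restr_bot.
  have [|b' [atb' b'b b'P]] := predM atb; first by exists d.
  have nb'Z : ~ s_sub b' Z.
    move=> /lb -/(_ atb')[E|bb']; apply: (prec_irreflM atb).
      by rewrite {1}E.
    exact: prec_transM bb' b'b.
  have : forall Y, isprefix b' Y -> good Y by apply: contrapT => /(ZP _ atb').
  apply; rewrite /isprefix => e ate; rewrite Y2P //; split=> [/b'P -/(_ ate)[]|[]].
  - by right.
  - by left.
  - by move=> eb'; apply: prec_transM eb' b'b.
  - by move=> ->.
exists (w ++ [:: s]).
apply: approx_trans _ (approx_sym (@MSO_cat _ k w [:: s])).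
apply: approx_trans _ (approx_otimes wP (@approx_refl _ k _)).
apply: (@restr_snoc _ _ _ _ _ b) => //.
- by move=> d atd; rewrite Y2P //; apply: Y1P.
- by move=> d atd; rewrite Y2P.
Qed.

(** The whole model is the prefix ending at the greatest atom. If there is no atom, the algebra has
    one element and the word is empty. *)
Theorem approx_word k : exists w, approx k M (MSO w).
Proof.
have [top topP] := comprM (Imp Fls Fls) (env [::]) 0.
have {}topP X : s_sub X top by apply: sub_atoms => a ata _; apply/topP.
suff [w wP] : exists w, approx k (restr (botM top)) (MSO w).
  by exists w; apply: approx_trans wP; apply: approx_sym; apply: restr_top.
have [/greatestM[b atb gb]|/forallNP nat] := EM (exists a : M, s_at a).
  apply: (@prefix_wordlike _ b) => // c atc; split=> // _.
  by have [->|] := gb c atc; [right|left].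
exists [::]; apply: restr_bot; apply: atoms_ext => a ata; case: (nat a ata).
Qed.

End ModelsOfT.

(** * Ultraproducts and the space of complete theories *)

Section Ultraproduct.
Context {Sigma : finType} (U : set_system nat) {UU : UltraFilter U}.
Variable M : nat -> structure Sigma.

Let P := forall k, M k.
Let ueq (a b : P) : Prop := U [set k | a k = b k].

(** The quotient modulo [U] is a type of predicates, and the relations are read on chosen
    representatives. Independence of the choice is replaced by [ucls_rep]: the representative of the
    class of [a] agrees with [a] almost everywhere. *)
Let udom := {c : P -> Prop | exists a, c = ueq a}.
Let ucls (a : P) : udom := exist _ (ueq a) (ex_intro _ a erefl).
Let urep (X : udom) : P := sval (cid (svalP X)).

Let urepK (X : udom) : ucls (urep X) = X.
Proof.
case: X => c pc; rewrite /ucls /urep /=; case: (cid _) => a /= ca.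
by move: pc; rewrite ca => pc; congr exist; apply: Prop_irrelevance.
Qed.

Let ucls_rep (a : P) : U [set k | urep (ucls a) k = a k].
Proof.
rewrite /urep; case: (cid _) => b /= ab; rewrite -/(ueq b a) -ab.
by apply: filterS filterT => k.
Qed.

Let urep_eq (X Y : udom) : U [set k | urep X k = urep Y k] -> X = Y.
Proof.
move=> XY; rewrite -(urepK X) -(urepK Y).
have E : ueq (urep X) = ueq (urep Y).
  apply/funext => b; apply/propext; split=> H; apply: filterS2 XY H => k /= -> //.
rewrite /ucls; move: (ex_intro _ (urep X) _) (ex_intro _ (urep Y) _).
by rewrite E => p q; congr exist; apply: Prop_irrelevance.
Qed.

Definition ultraproduct : structure Sigma :=
  {| dom := udom;
     s_sub := fun X Y => U [set k | s_sub (urep X k) (urep Y k)];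
     s_prec := fun X Y => U [set k | s_prec (urep X k) (urep Y k)];
     s_at := fun X => U [set k | s_at (urep X k)];
     s_bot := ucls (fun k => s_bot (M k));
     s_lab := fun s X => U [set k | s_lab s (urep X k)] |}.

Lemma ultra_imp (A B : set nat) : (U A -> U B) <-> U [set k | A k -> B k].
Proof.
split=> [H|UAB UA]; last by apply: filterS2 UAB UA => k; apply.
have [/H UB|UnA] := in_ultra_setVsetC A UU; first by apply: filterS UB => k Bk _.
by apply: filterS UnA => k nAk /nAk.
Qed.

(** The theorem of Łoś, by induction on [f]. That [U] is an ultrafilter matters for implications and
    for universal quantifiers. *)
Lemma los (e : nat -> ultraproduct) f :
  sat e f <-> U [set k | sat (fun x => urep (e x) k) f].
Proof.
have evE (d : nat -> ultraproduct) t :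
    U [set k | urep (eval_term d t) k = eval_term (fun x => urep (d x) k) t].
  by case: t => [x|] /=; [apply: filterS filterT => k|apply: ucls_rep].
elim: f e => [t u|t u|t u|t|s t||g IHg h IHh|x g IHg] e /=.
- split=> [E|H]; last first.
    apply: urep_eq; apply: filterS3 H (evE e t) (evE e u) => k /= -> -> -> //.
  by apply: filterS2 (evE e t) (evE e u) => k /= <- <-; rewrite E.
- by split=> H; apply: filterS3 H (evE e t) (evE e u) => k /= + E1 E2; rewrite ?E1 ?E2.
- by split=> H; apply: filterS3 H (evE e t) (evE e u) => k /= + E1 E2; rewrite ?E1 ?E2.
- by split=> H; apply: filterS2 H (evE e t) => k /= + E1; rewrite ?E1.
- by split=> H; apply: filterS2 H (evE e t) => k /= + E1; rewrite ?E1.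
- by split=> // /filter_ex[].
- by rewrite IHg IHh; apply: ultra_imp.
- have updE' (a : ultraproduct) k :
      (fun y => urep (upd e x a y) k) = upd (fun y => urep (e y) k) x (urep a k).
    by apply/funext => y; rewrite /upd; case: eqP.
  split=> [H|H a]; last first.
    by apply/IHg; apply: filterS H => k /= /(_ (urep a k)); rewrite updE'.
  apply: contrapT => nU.
  have [//|Un] := in_ultra_setVsetC
    [set k | forall a, sat (upd (fun y => urep (e y) k) x a) g] UU.
  (* Counterexamples are chosen in every factor that has one, with the bottom as default elsewhere;
     their class then contradicts [H]. *)
  have witness k : exists a, (exists b, ~ sat (upd (fun y => urep (e y) k) x b) g) ->
      ~ sat (upd (fun y => urep (e y) k) x a) g.
    have [[b nb]|nex] := EM (exists b, ~ sat (upd (fun y => urep (e y) k) x b) g).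
      by exists b.
    by exists (s_bot (M k)) => /nex.
  pose a : P := fun k => sval (cid (witness k)).
  have /IHg Ua := H (ucls a).
  have : U set0; last exact: filter_not_empty.
  apply: filterS3 Un Ua (ucls_rep a) => k /= nk + E; rewrite updE' E.
  by apply: (svalP (cid (witness k))); apply/existsNP.
Qed.

Lemma models_ultraproduct f : sentence f ->
  models ultraproduct f <-> U [set k | models (M k) f].
Proof.
move=> sf; split=> [mf|H e].
  have /los H := mf (fun=> s_bot ultraproduct).
  by apply: filterS H => k /=; apply: sat_sentence.
by apply/los; apply: filterS H => k; apply.
Qed.

End Ultraproduct.

(** * The space S(T), the finite monoids S_k and the maps between them *)

Section Spectrum.
Context {Sigma : finType}.
Implicit Types (x y : ST Sigma) (M N : structure Sigma) (u v w : seq Sigma).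

(** No axiom is inspected: at the depth of the given axiom, both factors are equivalent to words, so
    the product is equivalent to their concatenation, which satisfies T. *)
Lemma models_otimes M N : models_all M T_MSO -> models_all N T_MSO ->
  models_all (otimes M N) T_MSO.
Proof.
move=> MT NT f Tf; pose g := univ_closure f.
have sg : sentence g := sentence_univ_closure f.
apply/(models_Alls _ (fv f)); rewrite -/(univ_closure f) -/g.
have [u Mu] := approx_word MT (depth g); have [v Nv] := approx_word NT (depth g).
have H := approx_trans (approx_otimes Mu Nv) (approx_sym (@MSO_cat _ (depth g) u v)).
by apply/(H g sg (leqnn _))/models_Alls/MSO_T.
Qed.

Lemma sentence_T (f : formula Sigma) : T_MSO f -> sentence f.
Proof.
case=> //; last by move=> x z g _ _; apply: sentence_univ_closure.
by rewrite /sentence; elim: (enum Sigma).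
Qed.

Section TheoryOf.
Variable M : structure Sigma.
Hypothesis MT : models_all M T_MSO.

Lemma Th_sat : exists N : structure Sigma, models_all N (Th M).
Proof. by exists M => f []. Qed.

Lemma Th_complete f : sentence f -> Th M f \/ Th M (Not f).
Proof.
move=> sf; have [mf|nmf] := EM (models M f); [by left|right; split=> [|e ef]].
  by rewrite /sentence /= cats0.
by apply: nmf; apply: sat_sentence ef.
Qed.

Definition ST_of : ST Sigma :=
  @MkST Sigma (Th M) (fun f fM => fM.1) Th_sat Th_complete
    (fun f Tf => conj (sentence_T Tf) (MT Tf)).

Lemma ST_ofP : models_all M ST_of.
Proof. by move=> f []. Qed.

End TheoryOf.

Lemma ST_inj x y : (forall f, sentence f -> x f <-> y f) -> x = y.
Proof.
case: x y => x x1 x2 x3 x4 [y y1 y2 y3 y4] /= H.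
have E : x = y.
  by apply: pred_ext => f; split=> [xf|yf]; apply/H => //; [apply: x1|apply: y1].
move: x1 x2 x3 x4; rewrite E => x1 x2 x3 x4.
by congr MkST; apply: Prop_irrelevance.
Qed.

Definition model_of x : structure Sigma := sval (cid (ST_sat x)).

Lemma model_ofP x : models_all (model_of x) x.
Proof. exact: svalP (cid (ST_sat x)). Qed.

Lemma models_T x M : models_all M x -> models_all M T_MSO.
Proof. by move=> Mx f /(ST_T x) /Mx. Qed.

Lemma approx_models k x M N : models_all M x -> models_all N x -> approx k M N.
Proof. by move=> Mx Nx f sf _; rewrite -(STE Mx sf) -(STE Nx sf). Qed.

Lemma approx_classE k M N : approx k M N -> approx_class k M = approx_class k N.
Proof.
move=> MN; apply/seteqP; split=> K /= H; first exact: approx_trans (approx_sym MN) H.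
exact: approx_trans MN H.
Qed.

Lemma Sk_inj k (c d : Sk Sigma k) :
  (c : structure Sigma -> Prop) = (d : structure Sigma -> Prop) -> c = d.
Proof.
case: c d => c pc [d pd] /= E; move: pc pd; rewrite E => pc pd.
by rewrite (Prop_irrelevance pc pd).
Qed.

Lemma SkP k (c : Sk Sigma k) : exists w, c = word_class k w.
Proof. by have [w cw] := Sk_word c; exists w; apply: Sk_inj. Qed.

Lemma word_class_eq k u v : word_class k u = word_class k v <-> word_approx k u v.
Proof.
split=> [E|uv]; last exact/Sk_inj/approx_classE.
have : Sk_class (word_class k v) (MSO v) by apply: approx_refl.
by rewrite -E.
Qed.

Lemma Sk_class_eq k (c : Sk Sigma k) M :
  c M -> (c : structure Sigma -> Prop) = approx_class k M.
Proof. by have [w ->] := SkP c => /approx_classE. Qed.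

(** It is [approx_word] that makes the class of a model of T a member of S_k, whose elements must
    contain a word. *)
Lemma rank_class_subproof k x : exists w, approx_class k (model_of x) = approx_class k (MSO w).
Proof.
have [w Mw] := approx_word (models_T (@model_ofP x)) k.
by exists w; apply: approx_classE.
Qed.

Definition rank_class k x : Sk Sigma k := MkSk (rank_class_subproof k x).

Lemma rank_classE k x M : models_all M x -> (rank_class k x : structure Sigma -> Prop) = approx_class k M.
Proof. by move=> Mx; apply/approx_classE/approx_models/Mx/model_ofP. Qed.

Lemma rank_class_word k x M w : models_all M x -> approx k M (MSO w) -> rank_class k x = word_class k w.
Proof. by move=> Mx Mw; apply: Sk_inj; rewrite (rank_classE k Mx); apply: approx_classE. Qed.

Lemma rank_class_mem k x y f : rank_class k x = rank_class k y -> sentence f -> depth f <= k -> x f <-> y f.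
Proof.
move=> E sf fk; rewrite (STE (@model_ofP x) sf) (STE (@model_ofP y) sf).
suff : approx k (model_of x) (model_of y) by apply.
have : Sk_class (rank_class k y) (model_of y) by apply: approx_refl.
by rewrite -E.
Qed.

Lemma rank_class_separates x y : (forall k, rank_class k x = rank_class k y) -> x = y.
Proof. by move=> E; apply: ST_inj => f sf; apply: rank_class_mem (E (depth f)) sf _. Qed.

Lemma Sk_mul_subproof k (c d : Sk Sigma k) : exists w,
  [set K | exists M N, [/\ c M, d N & approx k (otimes M N) K]] = approx_class k (MSO w).
Proof.
have [[u ->] [v ->]] := (SkP c, SkP d); exists (u ++ v).
rewrite (approx_classE (@MSO_cat _ k u v)); apply/seteqP; split=> [K [M [N [uM vN MNK]]]|K H].
  exact: approx_trans (approx_otimes uM vN) MNK.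
by exists (MSO u), (MSO v); split=> //; apply: approx_refl.
Qed.

Definition Sk_mul k (c d : Sk Sigma k) : Sk Sigma k := MkSk (Sk_mul_subproof c d).

Lemma Sk_mulE k (c d : Sk Sigma k) M N : c M -> d N ->
  (Sk_mul c d : structure Sigma -> Prop) = approx_class k (otimes M N).
Proof.
by move=> cM dN; apply: Sk_class_eq; exists M, N; split=> //; apply: approx_refl.
Qed.

Lemma Sk_mul_word k u v :
  Sk_mul (word_class k u) (word_class k v) = word_class k (u ++ v).
Proof.
apply: Sk_inj; rewrite (@Sk_mulE _ _ _ (MSO u) (MSO v)); try exact: approx_refl.
exact/approx_classE/approx_sym/MSO_cat.
Qed.

Lemma parent_word k k' (kk' : k <= k') w :
  parent kk' (word_class k' w) = word_class k w.
Proof.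
apply: Sk_inj; apply: Sk_class_eq; exists (MSO w); exact: approx_refl.
Qed.

Lemma Sk_finite k : finite_set [set: Sk Sigma k].
Proof.
pose g (t : tau (Sigma := Sigma) k 0) : Sk Sigma k :=
  (* Types realized by no word are sent to the class of the empty word, an arbitrary default; only
     surjectivity of [g] is wanted. *)
  if pselect (exists w, rank_type k (MSO w) = t) is left tP
  then word_class k (sval (cid tP)) else word_class k [::].
apply: (@sub_finite_set _ _ (g @` setT)); last exact/finite_image/finite_finset.
move=> c _; have [w ->] := SkP c; exists (rank_type k (MSO w)) => //.
rewrite /g; case: pselect => [tP|[]]; last by exists w.
by apply/word_class_eq/approxP; case: (cid tP).
Qed.

Definition ST_mul x y : ST Sigma :=
  ST_of (models_otimes (models_T (@model_ofP x)) (models_T (@model_ofP y))).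

Lemma rank_class_mul k x y : rank_class k (ST_mul x y) = Sk_mul (rank_class k x) (rank_class k y).
Proof.
apply: Sk_inj; rewrite (rank_classE k (@ST_ofP _ _)) (Sk_mulE (M := model_of x) (N := model_of y)) //;
exact: approx_refl.
Qed.

(** Two models of a complete theory are equivalent at every rank, and equivalence at the depth of a
    sentence passes to products. *)
Lemma ST_mulE x y M N : models_all M x -> models_all N y ->
  (ST_mul x y : formula Sigma -> Prop) = Th (otimes M N).
Proof.
move=> Mx Ny; apply: pred_ext => f.
have xM := approx_models (k := depth f) (@model_ofP x) Mx.
have yN := approx_models (k := depth f) (@model_ofP y) Ny.
by split=> -[sf mf]; split=> //; apply/(approx_otimes xM yN sf (leqnn _)).
Qed.

Definition ST_one : ST Sigma := ST_of (@MSO_T Sigma [::]).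

Lemma rank_class_one k : rank_class k ST_one = word_class k [::].
Proof. exact: rank_class_word (@ST_ofP _ _) (approx_refl _). Qed.

Lemma Sk_mulA k : associative (@Sk_mul k).
Proof.
move=> c d e; have [[[u ->] [v ->]] [w ->]] := (SkP c, SkP d, SkP e).
by rewrite !Sk_mul_word catA.
Qed.

Lemma Sk_mul1l k : left_id (word_class k [::]) (@Sk_mul k).
Proof. by move=> c; have [u ->] := SkP c; rewrite Sk_mul_word. Qed.

Lemma Sk_mul1r k : right_id (word_class k [::]) (@Sk_mul k).
Proof. by move=> c; have [u ->] := SkP c; rewrite Sk_mul_word cats0. Qed.

(** The law holds in each S_k, where the product is concatenation of representatives, and the maps
    to the S_k are multiplicative and jointly injective. The unit laws are obtained in the same
    way. *)
Lemma ST_mulA : associative ST_mul.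
Proof. by move=> x y z; apply: rank_class_separates => k; rewrite !rank_class_mul Sk_mulA. Qed.

Lemma ST_mul1l : left_id ST_one ST_mul.
Proof. by move=> x; apply: rank_class_separates => k; rewrite rank_class_mul rank_class_one Sk_mul1l. Qed.

Lemma ST_mul1r : right_id ST_one ST_mul.
Proof. by move=> x; apply: rank_class_separates => k; rewrite rank_class_mul rank_class_one Sk_mul1r. Qed.

(** By compatibility, the truth value of a sentence of depth at most [k] is constant along [w] from
    index [k] on. The ultrafilter extends the filter of tails, so the ultraproduct inherits this
    value. *)
Lemma ST_lift (w : nat -> seq Sigma) :
  (forall k k', k <= k' -> word_approx k (w k) (w k')) ->
  exists x, forall k, rank_class k x = word_class k (w k).
Proof.
move=> wP; have [U [UU Uoo]] := ultraFilterLemma (F := \oo) _.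
pose M := ultraproduct U (fun k => MSO (w k)).
have Uge k : U [set k' | k <= k'] by apply: Uoo; exists k.
have MT : models_all M T_MSO.
  move=> f Tf; apply/models_ultraproduct; first exact: sentence_T.
  by apply: filterS filterT => k _; apply: MSO_T.
exists (ST_of MT) => k; apply: rank_class_word (@ST_ofP _ MT) _ => f sf fk.
rewrite models_ultraproduct //; split=> [H|H].
  have [k' [/= H' kk']] := filter_ex (filterI H (Uge k)).
  exact/(wP k k' kk' f sf fk).
by apply: filterS (Uge k) => k' /= kk'; apply/(wP k k' kk' f sf fk).
Qed.

(** A basic set [basic f] containing [x] contains the fibre of [x] at rank [depth f]. Conversely,
    the fibre of [x] at rank [k] is the basic set of a Hintikka sentence. *)
Lemma nbhs_ST x (A : set (ST Sigma)) :
  nbhs x A <-> exists k, [set y | rank_class k y = rank_class k x] `<=` A.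
Proof.
split=> [|[k kA]].
  rewrite nbhsE => -[B [[D Dsub <-] [f Df xf]] BA].
  have sf : sentence f := Dsub f Df.
  exists (depth f) => y /= E; apply: BA; exists f => //.
  by apply/(rank_class_mem E sf).
rewrite nbhsE; pose f := hintikka (rank_type k (model_of x)).
have sf : sentence f by apply: sentence_hintikka.
have fE y : basic f y <-> rank_class k y = rank_class k x.
  rewrite /basic /= (STE (@model_ofP y) sf); split=> [mf|E].
    have /sat_hintikka0/esym/approxP H := mf (fun=> s_bot _).
    by apply: Sk_inj; apply: approx_classE (approx_sym H).
  move=> e; apply/sat_hintikka0/approxP.
  have : Sk_class (rank_class k x) (model_of x) by apply: approx_refl.
  by rewrite -E.
exists (basic f) => [|y /fE/kA//]; split; last exact/fE.
by exists [set f] => [g -> //|]; rewrite bigcup_set1.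
Qed.

Lemma continuous_discrete (X : topologicalType) (D : choiceType)
    (g : X -> discrete_topology D) :
  (forall x : X, nbhs x [set y | g y = g x]) <-> continuous g.
Proof.
split=> [H x A /= nA|cg x].
  by apply: filterS (H x) => y /= ->; exact: nbhs_singleton.
by apply: (cg x [set g x]); exact: discrete_set1.
Qed.

Lemma rank_class_continuous k : continuous (rank_class k : ST Sigma -> discrete_topology (Sk Sigma k)).
Proof. by apply/continuous_discrete => x; apply/nbhs_ST; exists k. Qed.

Lemma ST_mul_continuous : continuous (fun xy : ST Sigma * ST Sigma => ST_mul xy.1 xy.2).
Proof.
move=> [x y] A /= /nbhs_ST[k kA].
exists ([set z | rank_class k z = rank_class k x], [set z | rank_class k z = rank_class k y]) => /=.
  by split; apply/nbhs_ST; exists k.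
by move=> [x' y'] /= [xx' yy']; apply: kA; rewrite /= !rank_class_mul xx' yy'.
Qed.

Definition ST_monoid_on : top_monoid_on (ST Sigma) :=
  TopMonoidOn ST_mulA ST_mul1l ST_mul1r ST_mul_continuous.

Lemma discrete_mul_continuous (D : choiceType) (X := discrete_topology D) (m : D -> D -> D) :
  continuous (fun xy : X * X => (m xy.1 xy.2 : X)).
Proof.
move=> [c d] A /= nA; exists ([set c], [set d]) => /=.
  by split; exact: discrete_set1.
by move=> [c' d'] /= [-> ->]; apply: nbhs_singleton nA.
Qed.

Definition Sk_monoid_on k : top_monoid_on (discrete_topology (Sk Sigma k)) :=
  @TopMonoidOn (discrete_topology (Sk Sigma k)) (@Sk_mul k) (word_class k [::])
    (@Sk_mulA k) (@Sk_mul1l k) (@Sk_mul1r k) (@discrete_mul_continuous _ (@Sk_mul k)).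

End Spectrum.

(** * Inverse limits *)

Section Limits.
Context {Sigma : finType}.
Implicit Types (x y : ST Sigma) (u v w : seq Sigma).

Let SM := TopMonoid (@ST_monoid_on Sigma).
Let SkM k := TopMonoid (@Sk_monoid_on Sigma k).
Let par k k' (h : is_true (k <= k')) := (parent h : SkM k' -> SkM k).

Lemma continuous_from_discrete (D : choiceType) (Y : topologicalType)
    (g : discrete_topology D -> Y) : continuous g.
Proof.
move=> x A nA; apply: (@filterS _ (nbhs x) _ [set x]); last exact: discrete_set1.
by move=> y /= ->; exact: nbhs_singleton.
Qed.

Lemma parent_rank_class k k' (kk' : k <= k') x : parent kk' (rank_class k' x) = rank_class k x.
Proof.
have [w E] := SkP (rank_class k' x); rewrite E parent_word.
have Mw : approx k' (model_of x) (MSO w).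
  by have : Sk_class (rank_class k' x) (MSO w) by rewrite E; apply: approx_refl.
by rewrite (rank_class_word (@model_ofP _ x) (approx_leq kk' Mw)).
Qed.

Lemma rank_class_hom k : tm_hom (rank_class k : SM -> SkM k).
Proof. by split; [exact: rank_class_continuous|exact: rank_class_one|move=> x y; exact: rank_class_mul]. Qed.

Lemma Sk_directed : directed_system (leI := fun k k' : nat => k <= k') (F := SkM) par.
Proof.
split.
- by move=> k /=.
- by move=> i j l /=; apply: leq_trans.
- by exists 0.
- by move=> i j; exists (maxn i j); rewrite leq_maxl leq_maxr.
- move=> i j ij; split; first exact: continuous_from_discrete.
    exact: parent_word.
  move=> c d; have [[u ->] [v ->]] := (SkP c, SkP d).
  by rewrite /par /= Sk_mul_word !parent_word Sk_mul_word.
- by move=> i ii c; have [u ->] := SkP c; exact: parent_word.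
- by move=> i j l ij jl il c; have [u ->] := SkP c; rewrite /par !parent_word.
Qed.

(** The value of the mediating map at a point is given by [ST_lift]. Its uniqueness, the unit and
    multiplicativity follow from separation of points, and its continuity from that of the maps
    [q k], as fibres are basic neighbourhoods. *)
Lemma ST_inverse_limit :
  inverse_limit (leI := fun k k' : nat => k <= k') (F := SkM) par (M := SM) rank_class.
Proof.
split; first by split=> [k|k k' kk' x]; [exact: rank_class_hom|exact: parent_rank_class].
move=> N q [qhom qpar].
have /choice[h hP] n : exists x, forall k, rank_class k x = q k n.
  have /choice[w wP] k : exists w, q k n = word_class k w by exact: SkP.
  have [k k' kk'|x xP] := @ST_lift Sigma w.
    by apply/word_class_eq; rewrite -wP -(qpar k k' kk') wP /par parent_word.
  by exists x => k; rewrite xP wP.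
exists h; split; last first.
  move=> g [_ gP]; apply/funext => n; apply: rank_class_separates => k.
  by rewrite hP -gP.
split; last by move=> k n; rewrite hP.
split.
- move=> n A /nbhs_ST[k kA].
  have [/continuous_discrete/(_ n) cq _ _] := qhom k.
  by apply: filterS cq => n' /= E; apply: kA; rewrite /= !hP.
- apply: rank_class_separates => k; rewrite hP; have [_ -> _] := qhom k.
  by rewrite /= rank_class_one.
- move=> m n; apply: rank_class_separates => k; rewrite hP; have [_ _ ->] := qhom k.
  by rewrite /= rank_class_mul !hP.
Qed.

(** * The system of quotients of the free monoid by the k-equivalences *)

Lemma word_approx_cat k u u' v v' :
  word_approx k u u' -> word_approx k v v' -> word_approx k (u ++ v) (u' ++ v').
Proof.
move=> /word_class_eq E /word_class_eq E'.
by apply/word_class_eq; rewrite -!Sk_mul_word E E'.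
Qed.

Lemma word_approx_finite k : finite_set (range (fun u => [set v | word_approx k u v])).
Proof.
apply: (@sub_finite_set _ _ ((fun c : Sk Sigma k => [set v | c (MSO v)]) @` setT)).
  by move=> _ [u _ <-]; exists (word_class k u).
exact/finite_image/Sk_finite.
Qed.

Definition word_approx_con k : fin_congruence Sigma :=
  @FinCongruence Sigma (word_approx k) (fun u => @approx_refl Sigma k (MSO u))
    (fun u v => @approx_sym Sigma k (MSO u) (MSO v))
    (fun u v w => @approx_trans Sigma k (MSO u) (MSO v) (MSO w))
    (@word_approx_cat k) (@word_approx_finite k).

Definition approx_con_of k : approx_con Sigma :=
  @ApproxCon Sigma (word_approx_con k) (ex_intro _ k erefl).

Let Q (rho : approx_con Sigma) := quot_monoid rho.
Let leQ (rho rho' : approx_con Sigma) := con_le rho rho'.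
Let qmap (rho rho' : approx_con Sigma) (h : leQ rho rho') := (quot_map h : Q rho' -> Q rho).

Lemma cls_eq (rho : fin_congruence Sigma) u v : cls rho u = cls rho v <-> rho u v.
Proof.
split=> [E|uv]; last exact/quot_inj/con_setE.
have : quot_class (cls rho v) v by apply: con_refl.
by rewrite -E.
Qed.

Lemma quot_mapE (rho rho' : fin_congruence Sigma) (le : con_le rho rho') w :
  quot_map le (cls rho' w) = cls rho w.
Proof.
apply: quot_inj; apply/seteqP; split=> [v [u /= wu uv]|v /= wv].
  exact: con_trans (le _ _ wu) uv.
by exists w => //; apply: con_refl.
Qed.

Lemma quot_directed : directed_system (leI := leQ) (F := Q) qmap.
Proof.
split.
- by move=> rho u v.
- by move=> r1 r2 r3 H12 H23 u v /H23 /H12.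
- by exists (approx_con_of 0).
- move=> r1 r2; have [[k1 E1] [k2 E2]] := (ac_approx r1, ac_approx r2).
  exists (approx_con_of (maxn k1 k2)).
  by split=> u v /= uv; rewrite ?E1 ?E2; apply: approx_leq uv; rewrite ?leq_maxl ?leq_maxr.
- move=> r1 r2 r12; split; first exact: continuous_from_discrete.
    exact: quot_mapE.
  move=> c d; have [[u ->] [v ->]] := (clsP c, clsP d).
  by rewrite /qmap /= quot_mulE !quot_mapE quot_mulE.
- by move=> r rr c; have [u ->] := clsP c; exact: quot_mapE.
- by move=> r1 r2 r3 H12 H23 H13 c; have [u ->] := clsP c; rewrite /qmap !quot_mapE.
Qed.

Definition rank_of (rho : approx_con Sigma) : nat := sval (cid (ac_approx rho)).

Lemma rank_ofP (rho : approx_con Sigma) : con_rel rho = word_approx (rank_of rho).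
Proof. exact: svalP (cid (ac_approx rho)). Qed.

Definition quot_class_of (rho : approx_con Sigma) x : quot rho :=
  cls rho (sval (cid (SkP (rank_class (rank_of rho) x)))).

Lemma quot_class_of_rank_word (rho : approx_con Sigma) x w :
  rank_class (rank_of rho) x = word_class (rank_of rho) w ->
  quot_class_of rho x = cls rho w.
Proof.
rewrite /quot_class_of; case: (cid _) => v /= -> /word_class_eq vw.
by apply/cls_eq; rewrite rank_ofP.
Qed.

(* The rank [k] is not determined by the congruence, hence the detour through
   the maximum of two ranks. *)
Lemma quot_class_of_word (rho : approx_con Sigma) k x w : con_rel rho = word_approx k ->
  rank_class k x = word_class k w -> quot_class_of rho x = cls rho w.
Proof.
move=> rk xw; have [u xu] := SkP (rank_class (maxn (rank_of rho) k) x).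
have xu' j : j <= maxn (rank_of rho) k -> rank_class j x = word_class j u.
  by move=> le; rewrite -(parent_rank_class le) xu parent_word.
rewrite (quot_class_of_rank_word (xu' _ (leq_maxl _ _))); apply/cls_eq; rewrite rk.
by apply/word_class_eq; rewrite -xw xu' ?leq_maxr.
Qed.

Lemma quot_class_ofE (rho : approx_con Sigma) k x w : con_rel rho = word_approx k ->
  quot_class_of rho x w <-> rank_class k x (MSO w).
Proof.
move=> rk; have [v xv] := SkP (rank_class k x).
by rewrite (quot_class_of_word rk xv) xv /= rk.
Qed.

Lemma quot_class_of_hom (rho : approx_con Sigma) : tm_hom (quot_class_of rho : SM -> Q rho).
Proof.
have rk := rank_ofP rho; set k := rank_of rho in rk.
split.
- apply/continuous_discrete => x; apply/nbhs_ST; exists k => y /= E.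
  have [w xw] := SkP (rank_class k x).
  by rewrite (quot_class_of_word rk xw) (quot_class_of_word rk (w := w)) // E.
- exact: quot_class_of_word rk (rank_class_one k).
- move=> x y; have [[u xu] [v yv]] := (SkP (rank_class k x), SkP (rank_class k y)).
  rewrite (quot_class_of_word rk xu) (quot_class_of_word rk yv) /= quot_mulE.
  by apply: (quot_class_of_word rk); rewrite rank_class_mul xu yv Sk_mul_word.
Qed.

(** A cone over the quotients restricts to the congruences [approx_con_of k], and [toSk] makes it a
    cone over the S_k, to which the limit property already proved applies. *)
Lemma ST_inverse_limit_quot : inverse_limit (leI := leQ) (F := Q) qmap (M := SM) quot_class_of.
Proof.
split.
  split=> [rho|rho rho' le x]; first exact: quot_class_of_hom.
  pose k := maxn (rank_of rho) (rank_of rho').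
  have [u xu] := SkP (rank_class k x).
  have xu' j : j <= k -> rank_class j x = word_class j u.
    by move=> lej; rewrite -(parent_rank_class lej) xu parent_word.
  rewrite (quot_class_of_rank_word (xu' _ (leq_maxl _ _))) (quot_class_of_rank_word (xu' _ (leq_maxr _ _))).
  exact: quot_mapE.
move=> N r [rhom rmap].
pose toSk k (C : quot (approx_con_of k)) : Sk Sigma k := word_class k (sval (cid (clsP C))).
have toSkE k w : toSk k (cls _ w) = word_class k w.
  by rewrite /toSk; case: cid => v /= /cls_eq/approx_sym/word_class_eq.
have con : cone (leI := fun k k' : nat => k <= k') (F := SkM) par
    (fun k n => toSk k (r (approx_con_of k) n)).
  split=> [j|j j' jj' n].
    have [cr r1 rM] := rhom (approx_con_of j); split.
    - apply/continuous_discrete => n; have /continuous_discrete/(_ n) := cr.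
      by apply: filterS => n' /= ->.
    - by rewrite r1; apply: toSkE.
    - move=> m n; rewrite rM.
      have [[u ->] [v ->]] := (clsP (r (approx_con_of j) m), clsP (r (approx_con_of j) n)).
      by rewrite /= quot_mulE !toSkE Sk_mul_word.
  have le : leQ (approx_con_of j) (approx_con_of j') by move=> u v; apply: approx_leq.
  rewrite -(rmap _ _ le); have [u ->] := clsP (r (approx_con_of j') n).
  by rewrite /qmap quot_mapE !toSkE /par parent_word.
have [h [[hhom hP] huniq]] := ST_inverse_limit.2 N _ con.
exists h; split.
  split=> // rho n; pose k := rank_of rho; have rk := rank_ofP rho.
  (* As records, [rho] and [approx_con_of k] are not identified although their relations coincide;
     the system map between their quotients serves as the comparison. *)
  have le : leQ rho (approx_con_of k) by move=> u v; rewrite rk.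
  rewrite -(rmap _ _ le).
  have := hP k n; have [u ->] := clsP (r (approx_con_of k) n).
  by rewrite toSkE => hu; rewrite (quot_class_of_word rk hu) /qmap quot_mapE.
move=> g [ghom gP]; apply: huniq; split=> // k n.
have [w gw] := SkP (rank_class k (g n)).
rewrite gw -(gP (approx_con_of k) n) (@quot_class_of_word (approx_con_of k) k (g n) w) //.
by rewrite toSkE.
Qed.

End Limits.

(** * Finite congruences *)

Section Recognizable.
Context {Sigma : finType}.
Implicit Types (u v w : seq Sigma).

Section Automaton.
Variables (m : nat) (st : seq Sigma -> nat) (delta : nat -> Sigma -> nat).
Hypothesis st_lt : forall u, st u < m.
Hypothesis st_rcons : forall u s, st (rcons u s) = delta (st u) s.

(* The variable [i.+3] stands for the set of positions after which the
   automaton is in state [i]. *)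
Definition run_init s : formula Sigma :=
  AllAt 0 (Imp (Lab s 0) (Imp (AllAt 1 (Or (Eq 0 1) (Prec 0 1)))
    (Sub 0 (st [:: s]).+3))).

(** The first premise says that 1 is the immediate successor of 0. Variables 0, 1 and 2 range over
    positions, whence the offset of three for the states. *)
Definition run_step i s : formula Sigma :=
  AllAt 0 (AllAt 1 (Imp (And (Prec 0 1) (AllAt 2 (Imp (Prec 0 2) (Or (Eq 1 2) (Prec 1 2)))))
    (Imp (Lab s 1) (Imp (Sub 0 i.+3) (Sub 1 (delta i s).+3))))).

Definition run : formula Sigma :=
  bigAnd ([seq run_init s | s <- enum Sigma] ++
          [seq run_step i s | i <- iota 0 m, s <- enum Sigma]).

(** The state variables stay free and are read universally. [run] only asks for closure under the
    transitions, so the sets may overlap or be too large; the actual run is the least solution, and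
    being in state [i] for all solutions means being in it for that one. *)
Definition accept i : formula Sigma :=
  Imp run (AllAt 0 (Imp (AllAt 1 (Or (Eq 0 1) (Prec 1 0))) (Sub 0 i.+3))).

Lemma sat_run w (e : nat -> MSO w) : sat e run <->
  (forall a, sval a = 0 -> e (st [:: letter a]).+3 a) /\
  (forall i a b, i < m -> sval b = (sval a).+1 -> e i.+3 a ->
    e (delta i (letter b)).+3 b).
Proof.
have initP s : sat e (run_init s) <->
    forall a, letter a = s -> sval a = 0 -> e (st [:: s]).+3 a.
  rewrite /run_init sat_AllAt; split=> [H a la a0|H _ [a ->]].
    have := H (eq a) (ex_intro _ a erefl); rewrite !sat_Imp sat_AllAt => H'.
    have {H'} : s_sub (eq a : MSO w) (e (st [:: s]).+3).
      apply: H'; first by exists a.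
      move=> _ [b ->]; rewrite sat_Or /= /upd /= prec_eqE a0.
      by case: (posnP (sval b)) => [b0|]; [left; congr eq; apply: val_inj; rewrite /= a0 b0|right].
    by apply.
  rewrite !sat_Imp sat_AllAt => -[b Eb lb] first0; have ab := eq_inj Eb.
  have ea : e (st [:: s]).+3 a.
    apply: H; first by rewrite ab.
    case: (posnP (sval a)) => // a_gt0.
    have lt0 : 0 < size w by apply: leq_trans (svalP a).
    pose z : position w := exist (fun i => i < size w) 0 lt0.
    have := first0 (eq z) (ex_intro _ z erefl); rewrite sat_Or /= /upd /= prec_eqE /=.
    by case=> // Ez; move: a_gt0; rewrite (eq_inj Ez).
  by move=> c <-.
have stepP i s : sat e (run_step i s) <->
    forall a b, letter b = s -> sval b = (sval a).+1 -> e i.+3 a -> e (delta i s).+3 b.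
  rewrite /run_step sat_AllAt; split=> [H a b lb ba ea|H _ [a ->]].
    have := H (eq a) (ex_intro _ a erefl); rewrite sat_AllAt => /(_ (eq b) (ex_intro _ b erefl)).
    rewrite sat_Imp sat_And sat_AllAt => H'.
    have {H'} : s_lab s (eq b : MSO w) -> s_sub (eq a : MSO w) (e i.+3) ->
        s_sub (eq b : MSO w) (e (delta i s).+3).
      apply: H'; split; first by rewrite /= /upd /= prec_eqE ba.
      move=> _ [c ->]; rewrite sat_Imp sat_Or /= /upd /= !prec_eqE ba => ac.
      move: ac; rewrite leq_eqVlt => /predU1P[bc|]; last by right.
      by left; congr eq; apply: val_inj; rewrite /= ba bc.
    by apply; [exists b|move=> c <-|].
  rewrite sat_AllAt => _ [b ->]; rewrite sat_Imp sat_And sat_AllAt => -[+ nob].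
  rewrite /= /upd /= prec_eqE => ab [b' Eb lb] ea; have bb' := eq_inj Eb.
  have eb : e (delta i s).+3 b.
    apply: (H a); [by rewrite bb'| |exact: ea].
    apply/eqP; rewrite eqn_leq ab andbT.
    have lt1 : (sval a).+1 < size w by apply: leq_trans (svalP b).
    pose c : position w := exist (fun i => i < size w) _ lt1.
    have := nob (eq c) (ex_intro _ c erefl); rewrite sat_Imp sat_Or /= /upd /= !prec_eqE /=.
    by case=> // [Ec|/ltnW//]; rewrite (eq_inj Ec).
  by move=> c <-.
rewrite sat_bigAnd; split=> [H|[H1 H2] f].
  split=> [a a0|i a b im ba ea].
    have /initP : sat e (run_init (letter a)).
      by apply: H; rewrite mem_cat map_f ?mem_enum.
    exact.
  have /stepP : sat e (run_step i (letter b)).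
    by apply: H; rewrite mem_cat (allpairs_f run_step) ?mem_enum ?orbT ?mem_iota.
  by apply; first exact: erefl; eassumption.
rewrite mem_cat => /orP[/mapP[s _ ->]|/allpairsP[[i s] /= [+ _ ->]]].
  by apply/initP => a <-; apply: H1.
by rewrite mem_iota => im; apply/stepP => a b <-; apply: H2.
Qed.

Lemma st_take w (a : position w) :
  st (take (sval a).+1 w) = delta (st (take (sval a) w)) (letter a).
Proof.
rewrite (take_nth (letter a) (svalP a)) st_rcons; congr delta.
by rewrite [RHS]/letter (tnth_nth (letter a)).
Qed.

Lemma run_correct w (e : nat -> MSO w) : sat e run ->
  forall a, e (st (take (sval a).+1 w)).+3 a.
Proof.
move=> /sat_run[H1 H2] [i]; elim: i => [|i IH] ilt /=.
  pose a : position w := exist (fun i => i < size w) 0 ilt.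
  have -> : st (take 1 w) = st [:: letter a] by rewrite (st_take a) /= take0 -st_rcons.
  exact: (H1 a erefl).
pose b : position w := exist (fun i => i < size w) i.+1 ilt.
have -> : st (take i.+2 w) = delta (st (take i.+1 w)) (letter b) by rewrite (st_take b).
have IHa := IH (ltnW ilt); exact: (H2 _ (exist _ i (ltnW ilt)) b (st_lt _) erefl IHa).
Qed.

(** The empty word is excluded because it has no last position, which would make [accept i] vacuous
    for every [i]. *)
Lemma models_accept w i : w != [::] -> models (MSO w) (accept i) <-> i = st w.
Proof.
move=> w0; have lt0 : 0 < size w by rewrite lt0n size_eq0.
have ltl : (size w).-1 < size w by rewrite prednK.
pose l : position w := exist (fun i => i < size w) _ ltl.
have lastP (e : nat -> MSO w) a :
    sat (upd e 0 (eq a)) (AllAt 1 (Or (Eq 0 1) (Prec 1 0))) <-> a = l.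
  rewrite sat_AllAt; split=> [/(_ (eq l) (ex_intro _ l erefl))|-> _ [b ->]].
    rewrite sat_Or /= /upd /= prec_eqE => -[E|]; first exact: eq_inj E.
    by rewrite /= prednK // leqNgt (svalP a).
  rewrite sat_Or /= /upd /= prec_eqE.
  have : sval b <= (size w).-1 by rewrite -ltnS prednK // (svalP b).
  rewrite leq_eqVlt => /predU1P[E|]; last by right.
  by left; congr eq; apply: val_inj; rewrite /= E.
have takel : take (sval l).+1 w = w by rewrite /= prednK // take_size.
rewrite /accept; split=> [H|-> e].
  (* The actual run; subtracting 3 undoes the offset of the state variables. *)
  pose e : nat -> MSO w := fun x => fun a => st (take (sval a).+1 w) = x - 3.
  have := H e; rewrite sat_Imp sat_AllAt => /(_ _ (eq l) (ex_intro _ l erefl)).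
  rewrite sat_Imp => H'.
  have {H'} : s_sub (eq l : MSO w) (e i.+3).
    apply: H'; last exact/lastP.
    apply/sat_run; rewrite /e; split=> [a a0|j a b _ ba].
      by rewrite st_take a0 take0 -st_rcons !subSS subn0.
    by rewrite !subSS !subn0 => <-; rewrite st_take ba.
  by move/(_ l erefl); rewrite /e takel !subSS subn0.
rewrite sat_Imp sat_AllAt => /run_correct R _ [a ->]; rewrite sat_Imp => /lastP ->.
by rewrite /= /upd /= => _ <-; rewrite -takel; apply: R.
Qed.

End Automaton.

Lemma models_nonempty w : models (MSO w) (Ex 0 (At 0)) <-> w != [::].
Proof.
split=> [|w0 e].
  case: w => // /(_ (fun=> s_bot (MSO [::]))); rewrite sat_Ex.
  by case=> A [[i ilt]].
have lt0 : 0 < size w by rewrite lt0n size_eq0.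
by rewrite sat_Ex; exists (eq (exist (fun i => i < size w) 0 lt0)); eexists.
Qed.

Theorem fin_congruence_approx (rho : fin_congruence Sigma) :
  exists k, forall u v, word_approx k u v -> rho u v.
Proof.
pose cl u : set (seq Sigma) := [set v | rho u v].
have [s sE] := (finite_seqP _).1 (con_fin rho).
have cls u : cl u \in s by have : [set` s] (cl u) by rewrite -sE; exists u.
pose st u := index (cl u) s.
have st_lt u : st u < size s by rewrite index_mem.
have st_eq u v : st u = st v <-> rho u v.
  split=> [E|uv]; last by rewrite /st /cl (con_setE uv).
  have : cl v v by apply: con_refl.
  by rewrite -(nth_index (cl v) (cls v)) -/(st v) -E nth_index.
(* One word is chosen for each state that is reached, and the empty word by default. The transition
   through [rep] agrees with appending a letter because [rho] is a congruence. *)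
have /choice[rep repP] i : exists u, i < size s -> forall v, st v = i -> st u = i.
  have [[u ui]|n] := EM (exists u, st u = i); first by exists u.
  by exists [::] => _ v vi; case: n; exists v.
pose delta i a := st (rcons (rep i) a).
have st_rcons u a : st (rcons u a) = delta (st u) a.
  apply/st_eq; rewrite -!cats1; apply: con_cat; last exact: con_refl.
  by apply/st_eq/esym/repP.
pose phi i := univ_closure (accept (size s) st delta i).
(* The 1 is the depth of [Ex 0 (At 0)], which separates the empty word from the others; the maximum
   covers one acceptance sentence for each class. *)
pose k := maxn 1 (\max_(i < size s) depth (phi i)).
exists k => u v uv; apply/st_eq.
have k1 : 1 <= k by rewrite leq_maxl.
have nonempty : u != [::] <-> v != [::].
  by rewrite -!models_nonempty; apply: uv.
have [u0|v0] := eqVneq v [::].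
  have : ~ u != [::] by move/nonempty; rewrite u0.
  by move/negP; rewrite negbK u0 => /eqP ->.
have u0 := nonempty.2 v0.
(* The acceptance sentence for the final state of [u] passes from [u] to [v] and so identifies the
   final state of [v]. *)
apply/(models_accept st_lt st_rcons (st u) v0)/(models_Alls _ (fv _)).
have dk : depth (phi (st u)) <= k.
  by rewrite leq_max (leq_bigmax (Ordinal (st_lt u))) orbT.
apply/(uv _ (sentence_univ_closure _) dk)/models_Alls.
exact/(models_accept st_lt st_rcons).
Qed.

End Recognizable.

Theorem theorem4p11 (Sigma : finType) :
  exists (S : top_monoid_on (ST Sigma))
         (SK : forall k, top_monoid_on (discrete_topology (Sk Sigma k)))
         (p : forall k, ST Sigma -> Sk Sigma k),
  let SM := TopMonoid S in
  let SkM := fun k => TopMonoid (SK k) in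
  let par := fun k k' (h : is_true (k <= k')) =>
    (parent h : SkM k' -> SkM k) in
  [/\ forall (x y : ST Sigma) (M N : structure Sigma),
        models_all M x -> models_all N y ->
        (tm_mul S x y : formula Sigma -> Prop) = Th (otimes M N),
      forall k (c d : Sk Sigma k) (M N : structure Sigma),
        c M -> d N ->
        (tm_mul (SK k) c d : structure Sigma -> Prop) =
          approx_class k (otimes M N),
      forall k, finite_set [set: Sk Sigma k]
    & forall k (x : ST Sigma) (M : structure Sigma),
        models_all M x ->
        (p k x : structure Sigma -> Prop) = approx_class k M] /\
  [/\ directed_system (leI := fun k k' : nat => k <= k') (F := SkM) par
    & inverse_limit (leI := fun k k' : nat => k <= k') (F := SkM) par
        (M := SM) p] /\
  let Q := fun rho : approx_con Sigma => quot_monoid rho in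
  let leQ := fun rho rho' : approx_con Sigma => con_le rho rho' in
  let qmap := fun (rho rho' : approx_con Sigma) (h : leQ rho rho') =>
    (quot_map h : Q rho' -> Q rho) in
  [/\ forall k, exists rho : fin_congruence Sigma,
        con_rel rho = word_approx k,
      forall rho : fin_congruence Sigma, exists k,
        forall u v, word_approx k u v -> con_rel rho u v,
      forall k u v, tm_mul (SK k) (word_class k u) (word_class k v) =
        word_class k (u ++ v),
      directed_system (leI := leQ) (F := Q) qmap
    & exists q : forall rho : approx_con Sigma, ST Sigma -> quot rho,
        (forall (rho : approx_con Sigma) k,
           con_rel rho = word_approx k ->
           forall x w, q rho x w <-> p k x (MSO w)) /\
        inverse_limit (leI := leQ) (F := Q) qmap (M := SM) q].
Proof.
exists (@ST_monoid_on Sigma), (@Sk_monoid_on Sigma), (@rank_class Sigma).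
split; [split|split; [split|split]].
- exact: ST_mulE.
- exact: Sk_mulE.
- exact: Sk_finite.
- exact: rank_classE.
- exact: Sk_directed.
- exact: ST_inverse_limit.
- by move=> k; exists (word_approx_con k).
- exact: fin_congruence_approx.
- exact: Sk_mul_word.
- exact: quot_directed.
- by exists (@quot_class_of Sigma); split;
    [move=> rho k rk x w; exact: quot_class_ofE|exact: ST_inverse_limit_quot].
Qed.
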